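(* Let $n \ge 3$, let $p$ be a prime and let $G = \mathrm{PSL}_2(\mathbb{Q}_p)$. Let $f : F_n \to G$ be a homomorphism with dense image, and suppose that $\Gamma := f(F_n)$ is torsion-free. Then $f$ is redundant, i.e. there exists a proper free factor $A < F_n$ such that $\overline{f(A)} = G$.
   Context: $F_n$ denotes the free group on $n$ generators $x_1,\dots,x_n$. The group $\mathrm{PSL}_2(\mathbb{Q}_p)$ carries its usual topology induced from the $p$-adic topology; ''dense'' and closures $\overline{\,\cdot\,}$ are taken in this topology. A subgroup $A < F_n$ is a free factor if there exists a subgroup $B < F_n$ with $F_n = A * B$; it is a proper free factor if $B \ne 1$. A homomorphism $f: F_n \to G$ with dense image is called redundant if there is a proper free factor $A<F_n$ with $\overline{f(A)} = \overline{f(F_n)} = G$. *)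

(* Defs.v *)
From HB Require Import structures.
From mathcomp Require Import all_boot all_order all_algebra.
From mathcomp Require Import all_classical all_reals all_analysis.

Set Implicit Arguments.
Unset Strict Implicit.
Unset Printing Implicit Defensive.

Import Order.TTheory GRing.Theory Num.Theory.
Local Open Scope classical_set_scope.
Local Open Scope ring_scope.

(* The inverse limit of the rings Z / p^k Z.  A compatible family is given by
   the remainders x k in [0, p^k[; the condition below says at once that x k is
   reduced and that it is the residue of x k.+1.  Primality of p is only
   needed for Z_p to be an integral domain. *)
Record padic_int (p : nat) (p_pr : prime p) := PadicInt {
  padic_res : nat -> int;
  padic_resP : forall k, padic_res k = (padic_res k.+1 %% (p ^ k)%N%:Z)%Z }.

HB.instance Definition _ (p : nat) (p_pr : prime p) :=
  gen_eqMixin (padic_int p_pr).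
HB.instance Definition _ (p : nat) (p_pr : prime p) :=
  gen_choiceMixin (padic_int p_pr).

Section PadicInt.
Variables (p : nat) (p_pr : prime p).
Local Notation Zp := (padic_int p_pr).
Local Notation q k := ((p ^ k)%N%:Z).
Implicit Types x y z : Zp.

Lemma padic_intP x y : padic_res x =1 padic_res y -> x = y.
Proof.
case: x y => [x xP] [y yP] /= /funext exy; case: y / exy yP => yP.
by congr PadicInt; exact: Prop_irrelevance.
Qed.

Lemma modz_modS (a : int) k : ((a %% q k.+1)%Z %% q k)%Z = (a %% q k)%Z.
Proof.
rewrite {2}(divz_eq a (q k.+1)) expnSr PoszM mulrA mulrAC.
by rewrite modzMDl.
Qed.

Lemma padic_res_mod x k : (padic_res x k %% q k)%Z = padic_res x k.
Proof. by rewrite padic_resP modz_mod. Qed.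

(* The element of Z_p whose k-th residue is u k mod p^k. *)
Definition padic_mk (u : nat -> int)
    (uP : forall k, (u k = u k.+1 %[mod q k])%Z) : Zp.
Proof.
exists (fun k => (u k %% q k)%Z) => k.
by rewrite modz_modS uP.
Defined.

Lemma padic_res_compat x k :
  (padic_res x k = padic_res x k.+1 %[mod q k])%Z.
Proof. by rewrite {1}padic_resP modz_mod. Qed.

Lemma padic_cst_compat (a : int) (k : nat) : (a = a %[mod q k])%Z.
Proof. by []. Qed.

Lemma padic_opp_compat x k :
  (- padic_res x k = - padic_res x k.+1 %[mod q k])%Z.
Proof. by rewrite -modzNm padic_res_compat modzNm. Qed.

Lemma padic_add_compat x y k : (padic_res x k + padic_res y k =
  padic_res x k.+1 + padic_res y k.+1 %[mod q k])%Z.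
Proof. by rewrite -modzDm !padic_res_compat modzDm. Qed.

Lemma padic_mul_compat x y k : (padic_res x k * padic_res y k =
  padic_res x k.+1 * padic_res y k.+1 %[mod q k])%Z.
Proof. by rewrite -modzMm !padic_res_compat modzMm. Qed.

Definition padic_int_of (a : int) : Zp := padic_mk (padic_cst_compat a).
Definition padic_opp x : Zp := padic_mk (padic_opp_compat x).
Definition padic_add x y : Zp := padic_mk (padic_add_compat x y).
Definition padic_mul x y : Zp := padic_mk (padic_mul_compat x y).

Fact padic_addA : associative padic_add.
Proof.
by move=> x y z; apply: padic_intP => k /=; rewrite modzDml modzDmr addrA.
Qed.

Fact padic_addC : commutative padic_add.
Proof. by move=> x y; apply: padic_intP => k /=; rewrite addrC. Qed.

Fact padic_add0 : left_id (padic_int_of 0) padic_add.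
Proof.
by move=> x; apply: padic_intP => k /=; rewrite modzDml add0r padic_res_mod.
Qed.

Fact padic_addN : left_inverse (padic_int_of 0) padic_opp padic_add.
Proof. by move=> x; apply: padic_intP => k /=; rewrite modzDml addNr. Qed.

HB.instance Definition _ :=
  GRing.isZmodule.Build Zp padic_addA padic_addC padic_add0 padic_addN.

Fact padic_mulA : associative padic_mul.
Proof.
by move=> x y z; apply: padic_intP => k /=; rewrite modzMml modzMmr mulrA.
Qed.

Fact padic_mulC : commutative padic_mul.
Proof. by move=> x y; apply: padic_intP => k /=; rewrite mulrC. Qed.

Fact padic_mul1 : left_id (padic_int_of 1) padic_mul.
Proof.
by move=> x; apply: padic_intP => k /=; rewrite modzMml mul1r padic_res_mod.
Qed.

Fact padic_mulD : left_distributive padic_mul padic_add.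
Proof.
move=> x y z; apply: padic_intP => k /=.
by rewrite modzMml modzDml modzDmr mulrDl.
Qed.

Fact padic_1neq0 : padic_int_of 1 != 0.
Proof.
apply/eqP => /(congr1 (fun x => padic_res x 1)) /=; rewrite expn1 mod0z.
by rewrite modz_small // ltz_nat prime_gt1.
Qed.

HB.instance Definition _ := GRing.Zmodule_isComNzRing.Build Zp
  padic_mulA padic_mulC padic_mul1 padic_mulD padic_1neq0.

Definition padic_unit : {pred Zp} := fun x => `[< exists y, y * x = 1 >].
Definition padic_inv x : Zp := xget x [set y | y * x = 1].

Fact padic_mulV : {in padic_unit, left_inverse 1 padic_inv *%R}.
Proof.
by move=> x /asboolP[y yx1]; exact: (@xgetPex _ x [set z | z * x = 1] (ex_intro _ y yx1)).
Qed.

Fact padic_unitP x y : y * x = 1 -> padic_unit x.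
Proof. by move=> yx1; apply/asboolP; exists y. Qed.

Fact padic_inv_out : {in [predC padic_unit], padic_inv =1 id}.
Proof.
by move=> x /asboolPn xU; apply: xgetPN => y yx1; apply: xU; exists y.
Qed.

HB.instance Definition _ := GRing.ComNzRing_hasMulInverse.Build Zp
  padic_mulV padic_unitP padic_inv_out.

Lemma padic_neq0 x : x != 0 -> exists k, padic_res x k != 0.
Proof.
move=> x0; apply: contrapT => /forallNP x_eq0; move/eqP: x0; apply.
apply: padic_intP => k /=; rewrite mod0z.
by apply/eqP/negPn/negP; exact: x_eq0.
Qed.

Lemma padic_res_le x k m : (k <= m)%N ->
  padic_res x k = (padic_res x m %% q k)%Z.
Proof.
elim: m => [|m IHm]; first by rewrite leqn0 => /eqP->; rewrite padic_res_mod.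
rewrite leq_eqVlt => /predU1P[->|]; first by rewrite padic_res_mod.
rewrite ltnS => km; rewrite (IHm km) (padic_resP x m).
rewrite {2}(divz_eq (padic_res x m.+1) (q m)) -(subnK km) expnD PoszM mulrA.
by rewrite modzMDl.
Qed.

Fact padic_idomain x y : x * y = 0 -> (x == 0) || (y == 0).
Proof.
move=> xy0; apply/norP => -[/padic_neq0[k xk] /padic_neq0[l yl]].
move/(congr1 (fun z => padic_res z (k + l))): xy0 => /=; rewrite mod0z.
move: xk yl; rewrite (padic_res_le x (leq_addr l k)).
rewrite (padic_res_le y (leq_addl k l)).
move: (padic_res x _) (padic_res y _) => a b ak bl /eqP abkl.
have Da : ~~ (p ^ k %| `|a|)%N by apply: contra ak => d; apply/eqP/dvdz_mod0P.
have Db : ~~ (p ^ l %| `|b|)%N by apply: contra bl => d; apply/eqP/dvdz_mod0P.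
have : (p ^ (k + l) %| `|a| * `|b|)%N.
  by rewrite -abszM; apply/(@dvdz_mod0P (q (k + l)) (a * b))/eqP.
have a0 : (0 < `|a|)%N by move: Da; case: `|a|%N => //; rewrite dvdn0.
have b0 : (0 < `|b|)%N by move: Db; case: `|b|%N => //; rewrite dvdn0.
move: Da Db; rewrite !pfactor_dvdn ?muln_gt0 ?a0 // lognM // -!ltnNge => ak' bl'.
by apply/negP; rewrite -ltnNge -addSn leq_add // ltnW.
Qed.

HB.instance Definition _ :=
  GRing.ComUnitRing_isIntegral.Build Zp padic_idomain.

End PadicInt.

Definition padic (p : nat) (p_pr : prime p) : Type := {fraction (padic_int p_pr)}.

Section Padic.
Local Open Scope relation_scope.
Variables (p : nat) (p_pr : prime p).
Local Notation Qp := (padic p_pr).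

HB.instance Definition _ := GRing.Field.on Qp.

Definition padic_ideal (k : nat) : set Qp :=
  [set FracField.tofrac (p%:R ^+ k * z) | z in [set: padic_int p_pr]].

(* The p-adic topology: the p^k Z_p are a neighborhood basis of 0. *)
Definition padic_ent : set_system (Qp * Qp) :=
  filter_from [set: nat]
    (fun k => [set xy : Qp * Qp | padic_ideal k (xy.1 - xy.2)]).

Lemma padic_ideal0 k : padic_ideal k 0.
Proof. by exists 0 => //; rewrite mulr0; exact: (rmorph0 (@FracField.tofrac _)). Qed.

Lemma padic_idealN k (x : Qp) : padic_ideal k x -> padic_ideal k (- x).
Proof.
move=> [z _ <-]; exists (- z) => //.
by rewrite mulrN; exact: (rmorphN (@FracField.tofrac _)).
Qed.

Lemma padic_idealD k (x y : Qp) :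
  padic_ideal k x -> padic_ideal k y -> padic_ideal k (x + y).
Proof.
move=> [z _ <-] [t _ <-]; exists (z + t) => //.
by rewrite mulrDr; exact: (rmorphD (@FracField.tofrac _)).
Qed.

Lemma padic_ideal_le k l : (k <= l)%N -> padic_ideal l `<=` padic_ideal k.
Proof.
move=> kl _ [z _ <-]; exists (p%:R ^+ (l - k) * z) => //.
by rewrite mulrA -exprD subnKC.
Qed.

Fact padic_ent_filter : Filter padic_ent.
Proof.
apply: filter_from_filter => [|k l _ _]; first by exists 0%N.
exists (maxn k l) => // xy xyP; split; apply: padic_ideal_le xyP.
  exact: leq_maxl.
exact: leq_maxr.
Qed.

Fact padic_ent_refl (A : set (Qp * Qp)) : padic_ent A -> diagonal `<=` A.
Proof.
move=> [k _ kA] [x y] /diagonalP <-; apply: kA => /=.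
by rewrite subrr; exact: padic_ideal0.
Qed.

Fact padic_ent_inv (A : set (Qp * Qp)) : padic_ent A -> padic_ent A^-1.
Proof.
move=> [k _ kA]; exists k => // -[x y] /= xyk; apply: kA => /=.
by rewrite -opprB; exact: padic_idealN.
Qed.

Fact padic_ent_split (A : set (Qp * Qp)) :
  padic_ent A -> exists2 B, padic_ent B & B \; B `<=` A.
Proof.
move=> [k _ kA]; exists [set xy : Qp * Qp | padic_ideal k (xy.1 - xy.2)].
  by exists k.
move=> [x y] /= [z /= xz zy]; apply: kA => /=.
by rewrite -(subrKA z); exact: padic_idealD.
Qed.

HB.instance Definition _ := isUniform.Build Qp
  padic_ent_filter padic_ent_refl padic_ent_inv padic_ent_split.

End Padic.

Record SL2 (K : fieldType) :=
  MkSL2 { SL2_mx :> 'M[K]_2; _ : \det SL2_mx == 1 }.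
HB.instance Definition _ (K : fieldType) := [isSub for @SL2_mx K].
HB.instance Definition _ (K : fieldType) := [Choice of SL2 K by <:].

Section SL2group.
Variable K : fieldType.
Implicit Types A B C : SL2 K.

Lemma SL2_det A : \det A = 1. Proof. exact/eqP/(valP A). Qed.

Lemma SL2_unit A : (A : 'M[K]_2) \in unitmx.
Proof. by rewrite unitmxE SL2_det unitr1. Qed.

Fact SL2_one_det : \det (1%:M : 'M[K]_2) == 1. Proof. by rewrite det1. Qed.
Fact SL2_mul_det A B : \det (A *m B) == 1.
Proof. by rewrite det_mulmx !SL2_det mulr1. Qed.
Fact SL2_inv_det A : \det (invmx A) == 1.
Proof. by rewrite det_inv SL2_det invr1. Qed.

Definition SL2_one : SL2 K := MkSL2 SL2_one_det.
Definition SL2_mul A B : SL2 K := MkSL2 (SL2_mul_det A B).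
Definition SL2_inv A : SL2 K := MkSL2 (SL2_inv_det A).

Fact SL2_mulA : associative SL2_mul.
Proof. by move=> A B C; apply: val_inj; rewrite /= mulmxA. Qed.
Fact SL2_mul1g : left_id SL2_one SL2_mul.
Proof. by move=> A; apply: val_inj; rewrite /= mul1mx. Qed.
Fact SL2_mulg1 : right_id SL2_one SL2_mul.
Proof. by move=> A; apply: val_inj; rewrite /= mulmx1. Qed.
Fact SL2_mulVg : left_inverse SL2_one SL2_inv SL2_mul.
Proof. by move=> A; apply: val_inj; rewrite /= mulVmx ?SL2_unit. Qed.
Fact SL2_mulgV : right_inverse SL2_one SL2_inv SL2_mul.
Proof. by move=> A; apply: val_inj; rewrite /= mulmxV ?SL2_unit. Qed.

HB.instance Definition _ := isGroup.Build (SL2 K)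
  SL2_mulA SL2_mul1g SL2_mulg1 SL2_mulVg SL2_mulgV.

Definition eq_upto_sign A B : bool :=
  ((A : 'M[K]_2) == B) || ((A : 'M[K]_2) == - (B : 'M[K]_2)).

Fact eq_upto_sign_refl : reflexive eq_upto_sign.
Proof. by move=> A; rewrite /eq_upto_sign eqxx. Qed.
Fact eq_upto_sign_sym : symmetric eq_upto_sign.
Proof.
move=> A B; rewrite /eq_upto_sign; congr (_ || _); first exact: eq_sym.
by rewrite eq_sym eqr_oppLR.
Qed.
Fact eq_upto_sign_trans : transitive eq_upto_sign.
Proof.
move=> B A C; rewrite /eq_upto_sign => /orP[]/eqP-> // /orP[]/eqP->.
  by rewrite eqxx orbT.
by rewrite opprK eqxx.
Qed.

Canonical eq_upto_sign_equiv :=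
  EquivRel eq_upto_sign eq_upto_sign_refl eq_upto_sign_sym eq_upto_sign_trans.

End SL2group.

Definition PSL2 (K : fieldType) : Type := {eq_quot @eq_upto_sign K}%qT.
HB.instance Definition _ (K : fieldType) := Choice.on (PSL2 K).
HB.instance Definition _ (K : fieldType) := EqQuotient.on (PSL2 K).

Section PSL2group.
Local Open Scope quotient_scope.
Local Open Scope group_scope.
Variable K : fieldType.
Local Notation PSL := (PSL2 K).
Implicit Types (A B C : SL2 K) (x y z : PSL).

Definition PSL2_mul x y : PSL := \pi_PSL (repr x * repr y).
Definition PSL2_inv x : PSL := \pi_PSL (repr x)^-1.
Definition PSL2_one : PSL := \pi_PSL (1 : SL2 K).

Lemma PSL2_eqP A B : reflect (\pi_PSL A = \pi_PSL B) (eq_upto_sign A B).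
Proof. by apply: (iffP idP) => [AB|/eqquotP//]; apply/eqquotP. Qed.

Lemma PSL2_reprP A : eq_upto_sign (repr (\pi_PSL A)) A.
Proof. by apply/PSL2_eqP; rewrite reprK. Qed.

Lemma PSL2_pi_mul A B : PSL2_mul (\pi_PSL A) (\pi_PSL B) = \pi_PSL (A * B).
Proof.
apply/PSL2_eqP; move: (PSL2_reprP A) (PSL2_reprP B); rewrite /eq_upto_sign /=.
move: (repr _) (repr _) => A' B' /orP[]/eqP-> /orP[]/eqP->;
  by rewrite ?mulNmx ?mulmxN ?opprK eqxx ?orbT.
Qed.

Lemma PSL2_pi_inv A : PSL2_inv (\pi_PSL A) = \pi_PSL (A^-1).
Proof.
apply/PSL2_eqP; move: (PSL2_reprP A); rewrite /eq_upto_sign /=.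
move: (repr _) => A' /orP[]/eqP A'E; first by rewrite A'E eqxx.
apply/orP; right; apply/eqP/(can_inj (mulKmx (SL2_unit A'))).
by rewrite mulmxV ?SL2_unit// A'E mulmxN mulNmx opprK mulmxV ?SL2_unit.
Qed.

Fact PSL2_mulA : associative PSL2_mul.
Proof.
elim/quotW=> A; elim/quotW=> B; elim/quotW=> C.
by rewrite (PSL2_pi_mul A B) (PSL2_pi_mul B C) !PSL2_pi_mul mulgA.
Qed.
Fact PSL2_mul1g : left_id PSL2_one PSL2_mul.
Proof. by elim/quotW=> A; rewrite PSL2_pi_mul mul1g. Qed.
Fact PSL2_mulg1 : right_id PSL2_one PSL2_mul.
Proof. by elim/quotW=> A; rewrite PSL2_pi_mul mulg1. Qed.
Fact PSL2_mulVg : left_inverse PSL2_one PSL2_inv PSL2_mul.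
Proof. by elim/quotW=> A; rewrite PSL2_pi_inv PSL2_pi_mul mulVg. Qed.
Fact PSL2_mulgV : right_inverse PSL2_one PSL2_inv PSL2_mul.
Proof. by elim/quotW=> A; rewrite PSL2_pi_inv PSL2_pi_mul mulgV. Qed.

HB.instance Definition _ := isGroup.Build PSL
  PSL2_mulA PSL2_mul1g PSL2_mulg1 PSL2_mulVg PSL2_mulgV.

End PSL2group.

(* SL_2(Q_p) has the topology induced by 'M_2(Q_p). *)
HB.instance Definition _ (p : nat) (p_pr : prime p) :=
  Topological.copy (SL2 (padic p_pr))
    (initial_topology (@SL2_mx (padic p_pr))).

Section PSL2topology.
Local Open Scope quotient_scope.
Variables (p : nat) (p_pr : prime p).
Local Notation SL := (SL2 (padic p_pr)).
Local Notation PSL := (PSL2 (padic p_pr)).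

(* The quotient topology.  The library's [quotient_topology] cannot be copied
   onto PSL because it carries its own choiceType structure. *)
Definition PSL2_open (U : set PSL) : Prop := open ((\pi_PSL : SL -> PSL) @^-1` U).

Fact PSL2_openT : PSL2_open setT. Proof. exact: openT. Qed.
Fact PSL2_openI : setI_closed PSL2_open.
Proof. by move=> U V; exact: openI. Qed.
Fact PSL2_open_bigcup (I : Type) (U : I -> set PSL) :
  (forall i, PSL2_open (U i)) -> PSL2_open (\bigcup_i U i).
Proof. by move=> Uo; apply: bigcup_open => i _; exact: Uo. Qed.

HB.instance Definition _ := isOpenTopological.Build PSL
  PSL2_openT PSL2_openI PSL2_open_bigcup.

End PSL2topology.

(* (i, false) is the generator x_i and (i, true) its inverse. *)
Definition letter (n : nat) : Type := 'I_n * bool.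
Definition linv n (a : letter n) : letter n := (a.1, ~~ a.2).
Definition reduced n (w : seq (letter n)) : bool :=
  sorted (fun a b => b != linv a) w.

Record free_group (n : nat) :=
  FreeGroup { word :> seq ('I_n * bool); _ : reduced word }.
HB.instance Definition _ n := [isSub for @word n].
HB.instance Definition _ n := [Choice of free_group n by <:].

Section FreeGroup.
Variable n : nat.
Local Notation L := ('I_n * bool)%type.
Implicit Types (a b : L) (u v w : seq L).

Lemma linvK : involutive (@linv n).
Proof. by case=> i e; rewrite /linv negbK. Qed.

(* the reduced form of a :: w, for a reduced word w *)
Definition rcons_red a w : seq L :=
  if w is b :: w' then if b == linv a then w' else a :: w else [:: a].
(* the reduced form of u ++ v *)
Definition rcat u v := foldr rcons_red v u.
Definition rinv u := rev (map (@linv n) u).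

Lemma rcons_red_reduced a w : reduced w -> reduced (rcons_red a w).
Proof.
case: w => //= b w; case: eqVneq => [_ /path_sorted//|ba bw].
by rewrite /reduced /= ba.
Qed.

Lemma rcat_reduced u v : reduced v -> reduced (rcat u v).
Proof. by move=> vR; elim: u => //= a u IHu; exact: rcons_red_reduced. Qed.

Lemma rinv_reduced u : reduced u -> reduced (rinv u).
Proof.
rewrite /reduced /rinv rev_sorted sorted_map; apply: sub_sorted => a b /=.
by rewrite linvK eq_sym (can2_eq linvK linvK).
Qed.

Lemma rcons_redK a w : reduced w -> rcons_red a (rcons_red (linv a) w) = w.
Proof.
case: w => [|b w] /=; first by rewrite eqxx.
rewrite linvK; case: eqVneq => [->|ba _ /=]; last by rewrite eqxx.
by case: w => //= c w /andP[/negPf->].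
Qed.

Lemma rcat_rcons_red a t w : reduced w ->
  rcat (rcons_red a t) w = rcons_red a (rcat t w).
Proof.
move=> wR; case: t => //= b t; case: eqVneq => //= ->.
by rewrite rcons_redK // rcat_reduced.
Qed.

Lemma rcatA u v w : reduced w -> rcat u (rcat v w) = rcat (rcat u v) w.
Proof.
move=> wR; elim: u => //= a u IHu.
by rewrite rcat_rcons_red // IHu.
Qed.

Lemma rcats0 u : reduced u -> rcat u [::] = u.
Proof.
elim: u => //= a u IHu auR; rewrite IHu; last exact: path_sorted auR.
by case: u auR {IHu} => //= b u /andP[/negPf->].
Qed.

Lemma rcat_rinv u : rcat (rinv u) u = [::].
Proof.
elim: u => //= a u IHu; rewrite /rinv /= rev_cons /rcat foldr_rcons /=.
by rewrite linvK eqxx.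
Qed.

Lemma rinvK : involutive rinv.
Proof. by move=> u; rewrite /rinv map_rev revK mapK //; exact: linvK. Qed.

Lemma wordP (x : free_group n) : reduced x. Proof. exact: valP x. Qed.

Definition free_one : free_group n := @FreeGroup n [::] isT.
Definition free_mul (x y : free_group n) : free_group n :=
  FreeGroup (rcat_reduced x (wordP y)).
Definition free_inv (x : free_group n) : free_group n :=
  FreeGroup (rinv_reduced (wordP x)).

Fact free_mulA : associative free_mul.
Proof. by move=> x y z; apply: val_inj; rewrite /= rcatA ?wordP. Qed.
Fact free_mul1g : left_id free_one free_mul.
Proof. by move=> x; apply: val_inj. Qed.
Fact free_mulg1 : right_id free_one free_mul.
Proof. by move=> x; apply: val_inj; rewrite /= rcats0 ?wordP. Qed.
Fact free_mulVg : left_inverse free_one free_inv free_mul.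
Proof. by move=> x; apply: val_inj; rewrite /= rcat_rinv. Qed.
Fact free_mulgV : right_inverse free_one free_inv free_mul.
Proof.
by move=> x; apply: val_inj; rewrite /= -{1}(rinvK x) rcat_rinv.
Qed.

HB.instance Definition _ := isGroup.Build (free_group n)
  free_mulA free_mul1g free_mulg1 free_mulVg free_mulgV.

Definition free_gen (i : 'I_n) : free_group n := @FreeGroup n [:: (i, false)] isT.

End FreeGroup.

Section Subgroups.
Local Open Scope group_scope.
Variable G : groupType.
Implicit Types A B : set G.

Definition is_subgroup A : Prop := group_closed (mem A).

(* G is the internal free product A * B: the inclusions of A and B make G the
   coproduct of A and B in the category of groups.  A homomorphism from A to H
   is given by a function on G that is multiplicative on A. *)
Definition is_free_product A B : Prop :=
  forall (H : groupType) (a b : G -> H),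
    {in A &, {morph a : x y / x * y}} -> {in B &, {morph b : x y / x * y}} ->
  exists h : {multiplicative G -> H},
    [/\ {in A, h =1 a}, {in B, h =1 b} &
      forall h' : {multiplicative G -> H},
        {in A, h' =1 a} -> {in B, h' =1 b} -> h' =1 h].

Definition proper_free_factor A : Prop :=
  is_subgroup A /\
  exists B, [/\ is_subgroup B, is_free_product A B & B <> [set 1]].

Definition torsion_free A : Prop :=
  forall x, A x -> forall k, (0 < k)%N -> x ^+ k = 1 -> x = 1.

End Subgroups.

Definition redundant (n : nat) (G : topologicalType) (f : free_group n -> G) :
    Prop :=
  exists A : set (free_group n), [/\ proper_free_factor A,
    closure (f @` A) = closure (range f) & closure (range f) = [set: G]].

(* Main.v *)
(* Write x_1, ..., x_n for the basis and lift the images of the x_i to SL_2(Q_p),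
   which acts on its Bruhat-Tits tree.  Nielsen's method applies to this action:
   either some basis contains an element with an elliptic image a (one with
   integral trace), or the group acts so that only 1 fixes the base vertex, and
   then its image is discrete.  If a is trivial, the other basis elements already
   generate the image.  Otherwise a has infinite order, being torsion-free, so its
   powers accumulate at 1.  Not all traces of basis elements and of their pairwise
   products are integral, because the image would then be bounded; hence a basis
   containing the preimage of a can be chosen with a hyperbolic element b, and
   multiplying a further basis element by a high power of b gives a hyperbolic
   element h with no fixed point on the projective line in common with a.
   Conjugating small powers of a by powers of h, and using h^-1 as well, one
   approximates all unipotent matrices that are triangular in an eigenbasis of h.
   These generate SL_2(Q_p), so the rank 2 free factor belonging to a and h has
   dense image, and it is proper since n >= 3. *)
Require Import Defs.
From HB Require Import structures.
From mathcomp Require Import all_boot all_order all_algebra.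
From mathcomp Require Import all_classical all_reals all_analysis.
From mathcomp Require Import ring zify.

Set Implicit Arguments.
Unset Strict Implicit.
Unset Printing Implicit Defensive.

Import Order.TTheory GRing.Theory Num.Theory.
Local Open Scope classical_set_scope.
Local Open Scope ring_scope.

(** * The p-adic valuation *)

(** The tree is never constructed. Nielsen's method needs only the displacement [ell] of the base
    vertex and the Gromov product [overlap]. Both are read off matrix entries, and the ultrametric
    inequality of [overlap] comes from comparing points of the projective lines over Z/p^k. The
    obstacle is a tie: minimal total length still allows a letter to lose exactly one half at each
    end, and then nothing of it survives in a product. A second weight, made of codes of midpoints,
    excludes this. An elliptic a need not have eigenvectors over Q_p, so that a and h have no common
    fixed point is expressed by det(ah - ha) != 0. This condition is polynomial and invariant under
    conjugation, so its behaviour along powers of a diagonal matrix can be computed, which is how a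
    suitable h is found. Density is handled by congruences between matrices of SL_2; the topology of
    PSL_2 enters only at the end. Between the construction of the valuation and that point the field
    is known only through [padic_valued]. *)

Definition val_ge (K : fieldType) (v : K -> int) (k : int) (x : K) : bool :=
  (x == 0) || (k <= v x).

(* These properties characterize the field of p-adic numbers with its additive
   valuation; the value of v at 0 is irrelevant. *)
Record padic_valued (p : nat) (K : fieldType) (v : K -> int) : Prop := {
  padic_prime : prime p;
  padic_valM : forall x y, x != 0 -> y != 0 -> v (x * y) = v x + v y;
  padic_valD : forall k x y, val_ge v k x -> val_ge v k y -> val_ge v k (x + y);
  padic_valp : p%:R != 0 :> K /\ v p%:R = 1;
  padic_val_nat : forall (x : K) (k : nat), val_ge v 0 x ->
    exists m : nat, val_ge v k%:Z (x - m%:R);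
  padic_val_complete : forall s : nat -> K,
    (forall k : nat, val_ge v k%:Z (s k.+1 - s k)) ->
    exists x, forall k : nat, val_ge v k%:Z (x - s k) }.

Record padic_field (p : nat) := PadicField {
  pf_sort :> fieldType;
  pf_val : pf_sort -> int;
  pf_valP : padic_valued p pf_val }.

Section PadicIntegers.
Variables (p : nat) (p_pr : prime p).
Local Notation Zp := (padic_int p_pr).
Local Notation q k := ((p ^ k)%N%:Z).
Implicit Types x y z : Zp.

Lemma padic_res_nat (m : nat) k :
  padic_res (m%:R : Zp) k = (m%:Z %% q k)%Z.
Proof.
elim: m => [|m IHm]; first by rewrite /= .
by rewrite -addn1 natrD /= IHm modzDm PoszD.
Qed.

Lemma padic_resD x y k :
  padic_res (x + y) k = ((padic_res x k + padic_res y k) %% q k)%Z.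
Proof. by []. Qed.

Lemma padic_resB x y k :
  padic_res (x - y) k = ((padic_res x k - padic_res y k) %% q k)%Z.
Proof. by rewrite /= modzDmr. Qed.

Lemma padic_resM x y k :
  padic_res (x * y) k = ((padic_res x k * padic_res y k) %% q k)%Z.
Proof. by []. Qed.


Let q_neq0 j : q j != 0.
Proof. by rewrite eqz_nat -lt0n expn_gt0 prime_gt0. Qed.

(** The j-th residue of the quotient is the (j + k)-th residue of [x] divided by p^k; the division
    is exact because the k-th residue is zero. *)
Lemma padic_dvd x k : padic_res x k = 0 -> exists y, x = p%:R ^+ k * y.
Proof.
move=> xk0.
have qx j : (q k %| padic_res x (j + k)%N)%Z.
  by apply/dvdz_mod0P; rewrite -(padic_res_le x (leq_addl j k)).
have yP j : ((padic_res x (j + k)%N %/ q k)%Z =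
    (padic_res x (j.+1 + k)%N %/ q k)%Z %[mod q j])%Z.
  apply/eqP; rewrite eqz_mod_dvd -(@dvdz_mul2r (q k)) //.
  rewrite mulrBl !divzK // -PoszM -expnD -eqz_mod_dvd; apply/eqP.
  exact: padic_res_compat.
exists (padic_mk p_pr yP); apply: padic_intP => j.
rewrite -natrX padic_resM padic_res_nat [in RHS]/= modzMml modzMmr mulrC divzK //.
exact: (padic_res_le x (leq_addr k j)).
Qed.

Lemma padic_dvd_res x k : padic_res (p%:R ^+ k * x) k = 0.
Proof. by rewrite -natrX padic_resM padic_res_nat modzMml modzMr. Qed.

(** Bezout's identity inverts each residue modulo p^k. The coefficients are chosen separately at
    each level, but inverses modulo p^k are unique, so they are compatible. *)
Lemma padic_unit_res x : padic_res x 1 != 0 -> x \is a GRing.unit.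
Proof.
move=> x1; have cop k : coprimez (padic_res x k) (q k).
  case: k => [|k]; first by rewrite expn0 coprimezE coprimen1.
  rewrite coprimezE /= coprime_pexpr // coprime_sym prime_coprime //.
  apply: contra x1 => px.
  rewrite (padic_res_le x (isT : (1 <= k.+1)%N)) expn1.
  exact/eqP/dvdz_mod0P.
pose u k := (egcdz (padic_res x k) (q k)).1.
have uP k : (u k * padic_res x k = 1 %[mod q k])%Z.
  rewrite /u; case: egcdzP => a b /= E _; move/eqP: (cop k) E => -> E.
  have -> : 1 = b * q k + a * padic_res x k by rewrite addrC E.
  by rewrite modzMDl.
have uC k : (u k = u k.+1 %[mod q k])%Z.
  apply/eqP; rewrite eqz_mod_dvd -(@Gauss_dvdzl _ _ (padic_res x k)); last first.
    by rewrite coprimez_sym.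
  rewrite mulrBl -eqz_mod_dvd uP; apply/eqP.
  rewrite padic_resP modzMmr -[LHS]modz_modS -uP modz_modS //.
apply/asboolP; exists (padic_mk p_pr uC); apply: padic_intP => k.
by rewrite padic_resM /= modzMml uP.
Qed.

Lemma padic_factor x : x != 0 ->
  exists k u, u \is a GRing.unit /\ x = p%:R ^+ k * u.
Proof.
move=> /padic_neq0 xE; case: (ex_minnP xE) => -[|m] xm min_m.
  by rewrite padic_resP expn0 modz1 eqxx in xm.
have /padic_dvd[y xy] : padic_res x m = 0.
  by apply/eqP/negPn/negP => /min_m; rewrite ltnn.
exists m, y; split=> //; apply: padic_unit_res; apply: contra xm => /eqP/padic_dvd[z yz].
by rewrite xy yz mulrA -exprD addn1 padic_dvd_res.
Qed.

Lemma padic_p_unit : (p%:R : Zp) \isn't a GRing.unit.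
Proof.
apply/negP => /asboolP[y /(congr1 (fun z => padic_res z 1%N))].
rewrite mulrC -[p%:R]expr1 padic_dvd_res /= expn1 modz_small //.
by rewrite ltz_nat prime_gt1.
Qed.

Lemma padic_p_neq0 : (p%:R : Zp) != 0.
Proof.
apply/eqP => /(congr1 (fun z => padic_res z 2%N)).
rewrite padic_res_nat /= mod0z modz_small //.
  by move=> [p0]; move: p_pr; rewrite p0.
by rewrite ltz_nat /= -[X in (X < _)%N]expn1 ltn_exp2l // prime_gt1.
Qed.
End PadicIntegers.

Lemma fraction_div (R : idomainType) (x : {fraction R}) :
  exists a b : R, b != 0 /\ x = FracField.tofrac a / FracField.tofrac b.
Proof.
elim/quotW: x => r; exists (frac r).1, (frac r).2.
have d0 := denom_ratioP r.
split=> //; apply: (canRL (mulfK _)); first by rewrite tofrac_eq0.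
apply/eqP; rewrite !piE /FracField.equivf /FracField.mulf.
by rewrite !numden_Ratio ?mulf_neq0 ?oner_eq0 //; apply/eqP; ring.
Qed.

Section PadicNumbers.
Variables (p : nat) (p_pr : prime p).
Local Notation Zp := (padic_int p_pr).
Local Notation Qp := (padic p_pr).
Local Notation iota := (@FracField.tofrac Zp : Zp -> Qp).

Let P : Qp := p%:R.

Lemma iotap : iota p%:R = P. Proof. exact: rmorph_nat. Qed.

Let P0 : P != 0.
Proof. by rewrite -iotap tofrac_eq0 padic_p_neq0. Qed.


(** The condition [x != 0] stands under the existential so that choosing [k] gives a total function,
    arbitrary at 0. *)
Lemma padic_val_ex (x : Qp) : exists k : int,
  x != 0 -> exists2 u, u \is a GRing.unit & x = P ^ k * iota u.
Proof.
have [->|x0] := eqVneq x 0; first by exists 0.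
have [a [b [b0 xE]]] := fraction_div x.
have a0 : a != 0 by apply: contra x0 => /eqP a0; rewrite xE a0 tofrac0 mul0r.
have [k [u [uU aE]]] := padic_factor a0; have [l [w [wU bE]]] := padic_factor b0.
exists (k%:Z - l%:Z) => _; exists (u / w); first by rewrite unitrMl ?unitrV.
have w0 : iota w != 0 by rewrite tofrac_eq0; apply: contraTneq wU => ->; rewrite unitr0.
have iw : iota w^-1 = (iota w)^-1.
  by apply: (mulfI w0); rewrite divff // -tofracM divrr // tofrac1.
rewrite xE aE bE !tofracM !tofracXn iotap expfzDr // -exprnP -invr_expz -exprnP.
by rewrite invfM mulrACA iw.
Qed.

Definition pval (x : Qp) : int := projT1 (cid (padic_val_ex x)).

Lemma pvalP x : x != 0 -> exists2 u, u \is a GRing.unit & x = P ^ (pval x) * iota u.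
Proof. exact: (projT2 (cid (padic_val_ex x))). Qed.

Lemma padic_expz_unit (k : int) (z : Zp) (u : Zp) :
  u \is a GRing.unit -> P ^ k * iota u = iota z -> 0 <= k.
Proof.
case: k => // k uU; rewrite NegzE -invr_expz -exprnP => E.
have {E} : iota u = P ^+ k.+1 * iota z by rewrite -E mulVKf // expf_neq0.
rewrite -iotap -tofracXn -tofracM => /eqP.
rewrite tofrac_eq => /eqP uE.
move: uU; rewrite uE exprS -mulrA unitrM => /andP[pU _].
by move: (padic_p_unit p_pr); rewrite pU.
Qed.

Local Notation vge := (val_ge pval).

Lemma vge_ideal k (x : Qp) : vge k x <-> exists z, x = P ^ k * iota z.
Proof.
split.
  case/orP => [/eqP->|kx]; first by exists 0; rewrite tofrac0 mulr0.
  have [->|x0] := eqVneq x 0; first by exists 0; rewrite tofrac0 mulr0.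
  have [u _ {1}->] := pvalP x0.
  exists (p%:R ^+ `|pval x - k|%N * u).
  rewrite tofracM tofracXn iotap mulrA; congr (_ * _).
  rewrite exprnP -expfzDr // gez0_abs ?subr_ge0 //.
  by congr (_ ^ _); ring.
move=> [z xE]; apply/orP; have [|x0] := eqVneq x 0; first by left.
right; have [u uU xE2] := pvalP x0.
rewrite -subr_ge0; apply: (@padic_expz_unit _ z _ uU).
by rewrite expfzDr // mulrAC -xE2 xE mulrAC -expfzDr // subrr expr0z mul1r.
Qed.

Lemma vge_nat_ideal (k : nat) (x : Qp) : vge k%:Z x <-> padic_ideal k x.
Proof.
rewrite vge_ideal; split=> [[z ->]|[z _ <-]].
  by exists z => //; rewrite tofracM tofracXn iotap.
by exists z; rewrite tofracM tofracXn iotap.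
Qed.

Lemma padic_valuedP : padic_valued p pval.
Proof.
split; first exact: p_pr.
- move=> x y x0 y0; have xy0 := mulf_neq0 x0 y0.
  have [u uU xE] := pvalP x0; have [w wU yE] := pvalP y0.
  have [t tU xyE] := pvalP xy0.
  have E : P ^ (pval (x * y)) * iota t = P ^ (pval x + pval y) * iota (u * w).
    by rewrite -xyE [in LHS]xE [in LHS]yE tofracM expfzDr // mulrACA.
  apply/eqP; rewrite eq_le -[X in _ && X]subr_ge0 -[X in X && _]subr_ge0.
  apply/andP; split.
    apply: (@padic_expz_unit _ t (u * w)); first by rewrite unitrMl.
    rewrite expfzDr // mulrAC -E mulrAC -expfzDr // subrr expr0z mul1r //.
  apply: (@padic_expz_unit _ (u * w) t) => //.
  rewrite expfzDr // mulrAC E mulrAC -expfzDr // subrr expr0z mul1r //.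
- move=> k x y /vge_ideal[z ->] /vge_ideal[t ->]; apply/vge_ideal.
  by exists (z + t); rewrite tofracD mulrDr.
- split=> //; have [u uU E] := pvalP P0.
  apply/eqP; rewrite eq_le -[X in _ && X]subr_ge0 -[X in X && _]subr_ge0.
  apply/andP; split.
    apply: (@padic_expz_unit _ u 1); first exact: unitr1.
    by rewrite expfzDr // expr1z {1}E tofrac1; rewrite mulr1 mulrAC -expfzDr // subrr expr0z mul1r.
  apply: (@padic_expz_unit _ 1 u) => //.
  by rewrite expfzDr // mulrAC -E -[X in X * _]expr1z -expfzDr // subrr expr0z tofrac1.
- move=> x k /vge_ideal[z]; rewrite expr0z mul1r => ->.
  exists `|padic_res z k|%N; apply/vge_ideal.
  have [y yE] : exists y, z - (`|padic_res z k|%N)%:R = p%:R ^+ k * y.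
    apply: padic_dvd; rewrite padic_resB padic_res_nat gez0_abs ?padic_res_mod ?subrr ?mod0z //.
    by rewrite -padic_res_mod modz_ge0 // eqz_nat -lt0n expn_gt0 prime_gt0.
  by exists y; rewrite -exprnP -iotap -tofracXn -tofracM -yE tofracB rmorph_nat.
- move=> s sC.
  have /choice[d dP] : forall k : nat, exists z : Zp, s k.+1 - s k = P ^ k%:Z * iota z.
    by move=> k; exact/vge_ideal.
  (* Partial sums of a p-adic series: later terms vanish modulo p^k, so [t k] already has the k-th
     residue of the limit. *)
  pose t (k : nat) : Zp := \sum_(i < k) p%:R ^+ i * d i.
  have st k : s k = s 0%N + iota (t k).
    elim: k => [|k IHk]; first by rewrite /t big_ord0 tofrac0 addr0.
    rewrite /t big_ord_recr /= tofracD addrA -IHk tofracM tofracXn iotap.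
    by rewrite -[X in X * _]/(P ^ k%:Z) -dP addrC subrK.
  have lC k : (padic_res (t k) k = padic_res (t k.+1) k.+1 %[mod (p ^ k)%N%:Z])%Z.
    rewrite -(padic_res_compat (t k.+1) k) !padic_res_mod [in RHS]/t big_ord_recr.
    by rewrite padic_resD -/(t k) padic_dvd_res addr0 padic_res_mod.
  exists (s 0%N + iota (padic_mk p_pr lC)) => k; rewrite (st k) opprD addrACA subrr add0r.
  apply/vge_ideal; have [y yE] : exists y, padic_mk p_pr lC - t k = p%:R ^+ k * y.
    by apply: padic_dvd; rewrite padic_resB /= padic_res_mod subrr mod0z.
  by exists y; rewrite -exprnP -iotap -tofracXn -tofracM -yE tofracB.
Qed.

Definition padic_field_of : padic_field p := PadicField padic_valuedP.

End PadicNumbers.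

(** * Valuation rings and residues *)

Section Valuation.
Variables (p : nat) (K : padic_field p).
Local Notation v := (@pf_val p K).
Local Notation vge := (val_ge v).
Implicit Types (x y : K) (k l : int).

Lemma pvalM x y : x != 0 -> y != 0 -> v (x * y) = v x + v y.
Proof. exact: (padic_valM (pf_valP K)). Qed.

Lemma vgeD k x y : vge k x -> vge k y -> vge k (x + y).
Proof. exact: (padic_valD (pf_valP K)). Qed.

Lemma pval1 : v 1 = 0.
Proof. by have := pvalM (oner_neq0 K) (oner_neq0 K); rewrite mulr1; move: (v 1) => a; lia. Qed.

Lemma pvalN1 : v (-1) = 0.
Proof.
have N1 : (-1 : K) != 0 by rewrite oppr_eq0 oner_eq0.
by have := pvalM N1 N1; rewrite mulrNN mulr1 pval1; lia.
Qed.

Lemma pvalN x : v (- x) = v x.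
Proof.
have [->|x0] := eqVneq x 0; first by rewrite oppr0.
by rewrite -mulN1r pvalM // ?oppr_eq0 ?oner_eq0 // pvalN1 add0r.
Qed.

Lemma pvalV x : x != 0 -> v x^-1 = - v x.
Proof.
by move=> x0; have := pvalM x0 (invr_neq0 x0); rewrite divff // pval1; lia.
Qed.

Lemma pvalX x (n : nat) : x != 0 -> v (x ^+ n) = v x *+ n.
Proof.
move=> x0; elim: n => [|n IHn]; first by rewrite expr0 pval1.
by rewrite exprS pvalM ?expf_neq0 // IHn mulrS.
Qed.

Lemma p_neq0 : p%:R != 0 :> K. Proof. by case: (padic_valp (pf_valP K)). Qed.

Lemma pvalp : v p%:R = 1. Proof. by case: (padic_valp (pf_valP K)). Qed.

Lemma vgeE k x : x != 0 -> vge k x = (k <= v x).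
Proof. by rewrite /val_ge => /negPf->. Qed.

Lemma vge_0 k : vge k 0. Proof. by rewrite /val_ge eqxx. Qed.

Lemma vgeN k x : vge k (- x) = vge k x.
Proof. by rewrite /val_ge oppr_eq0 pvalN. Qed.

Lemma vgeB k x y : vge k x -> vge k y -> vge k (x - y).
Proof. by move=> xk yk; rewrite vgeD ?vgeN. Qed.

Lemma vgeM k l x y : vge k x -> vge l y -> vge (k + l) (x * y).
Proof.
have [->|x0] := eqVneq x 0; first by rewrite mul0r !vge_0.
have [->|y0] := eqVneq y 0; first by rewrite mulr0 !vge_0.
by rewrite !vgeE ?mulf_neq0 // pvalM //; lia.
Qed.

Lemma vgeW k l x : vge k x -> l <= k -> vge l x.
Proof. by move=> /orP[/eqP->|kx] lk; rewrite /val_ge ?eqxx // (le_trans lk kx) orbT. Qed.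

Lemma vgeM0 k x y : vge 0 x -> vge k y -> vge k (x * y).
Proof. by move=> x0 /(vgeM x0); rewrite add0r. Qed.

Lemma vgeM0r k x y : vge k x -> vge 0 y -> vge k (x * y).
Proof. by move=> xk y0; rewrite mulrC vgeM0. Qed.

Lemma vge1 : vge 0 1. Proof. by rewrite vgeE ?oner_eq0 // pval1. Qed.

Lemma vgeX0 x (n : nat) : vge 0 x -> vge 0 (x ^+ n).
Proof.
move=> x0; elim: n => [|n IHn]; first by rewrite expr0 vge1.
by rewrite exprS vgeM0.
Qed.

Lemma vge_nat (m : nat) : vge 0 m%:R.
Proof.
by elim: m => [|m IHm]; rewrite ?mulr0n ?vge_0 // mulrS vgeD ?vge1.
Qed.

Lemma vge_subC k x y : vge k (x - y) = vge k (y - x).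
Proof. by rewrite -vgeN opprB. Qed.

Lemma vge_sub_trans k x y z : vge k (x - y) -> vge k (y - z) -> vge k (x - z).
Proof. by move=> xy yz; rewrite -(subrKA y) vgeD. Qed.

Lemma vge_ex x : exists N : nat, vge (- N%:Z) x.
Proof.
by exists `|v x|%N; apply/orP; right; lia.
Qed.

Lemma vge_sep x : (forall k : nat, vge k%:Z x) -> x = 0.
Proof.
move=> xP; apply/eqP; apply: contraT => x0.
by have := xP `|v x|.+1; rewrite vgeE //; lia.
Qed.

Lemma vge_pM (k : nat) l x : vge l (p%:R ^+ k * x) = vge (l - k%:Z) x.
Proof.
have [->|x0] := eqVneq x 0; first by rewrite mulr0 !vge_0.
rewrite !vgeE ?mulf_neq0 ?expf_neq0 ?p_neq0 // pvalM ?expf_neq0 ?p_neq0 //.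
by rewrite pvalX ?p_neq0 // pvalp; lia.
Qed.

Lemma unit_neq0 x : ~~ vge 1 x -> x != 0.
Proof. by apply: contraNneq => ->; rewrite vge_0. Qed.

Lemma unitE x : vge 0 x -> ~~ vge 1 x -> v x = 0.
Proof.
move=> x0 x1; have xn := unit_neq0 x1.
by move: x0 x1; rewrite !vgeE //; lia.
Qed.

Lemma vge_unitV x : vge 0 x -> ~~ vge 1 x -> vge 0 x^-1.
Proof.
move=> x0 x1; have xn := unit_neq0 x1.
by rewrite vgeE ?invr_eq0 // pvalV // (unitE x0 x1).
Qed.

Lemma vge_unitM k x y : vge 0 x -> ~~ vge 1 x -> vge k (x * y) = vge k y.
Proof.
move=> x0 x1; apply/idP/idP; last exact: vgeM0.
move=> xy; rewrite -(mulKf (unit_neq0 x1) y); apply: vgeM0 => //.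
exact: vge_unitV.
Qed.

Lemma vge_nat_dense x (k : nat) : vge 0 x -> exists m : nat, vge k%:Z (x - m%:R).
Proof. exact: (padic_val_nat (pf_valP K)). Qed.

Lemma vge_complete (s : nat -> K) :
  (forall k : nat, vge k%:Z (s k.+1 - s k)) ->
  exists x, forall k : nat, vge k%:Z (x - s k).
Proof. exact: (padic_val_complete (pf_valP K)). Qed.

Lemma resid_subproof (k : nat) x : exists m : nat, vge 0 x ==> vge k%:Z (x - m%:R).
Proof.
have [x0|_] := boolP (vge 0 x); last by exists 0%N.
exact: vge_nat_dense.
Qed.

(** Taking the least [m] makes the residue depend only on the class modulo p^k, so that congruence
    becomes equality of naturals. *)
Definition resid (k : nat) x : nat := ex_minn (resid_subproof k x).

Lemma residP (k : nat) x : vge 0 x -> vge k%:Z (x - (resid k x)%:R).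
Proof. by move=> x0; rewrite /resid; case: ex_minnP => m; rewrite x0. Qed.

Lemma resid_lt (k : nat) x : (resid k x < p ^ k)%N.
Proof.
rewrite /resid; case: ex_minnP => m xm min_m.
apply: (@leq_ltn_trans (m %% p ^ k)); last by rewrite ltn_mod expn_gt0 (prime_gt0 (padic_prime (pf_valP K))).
apply: min_m; apply/implyP => x0; move: xm; rewrite x0 /= => xm.
apply: (vge_sub_trans xm); rewrite {1}(divn_eq m (p ^ k)) natrD addrK mulnC natrM natrX.
by rewrite vge_pM subrr vge_nat.
Qed.

Lemma resid_eq (k : nat) x y : vge 0 x -> vge 0 y ->
  (resid k x == resid k y) = vge k%:Z (x - y).
Proof.
move=> x0 y0; apply/eqP/idP => [E|xy].
  by apply: (vge_sub_trans (residP k x0)); rewrite E vge_subC residP.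
have H m : vge k%:Z (x - m%:R) = vge k%:Z (y - m%:R).
  apply/idP/idP; apply: vge_sub_trans; by rewrite // vge_subC.
rewrite /resid; case: ex_minnP => m; rewrite x0 /= => xm min_m.
case: ex_minnP => m'; rewrite y0 /= => ym min_m'; apply/eqP; rewrite eqn_leq.
by rewrite min_m ?H ?x0 ?y0 ?ym //= min_m' // -H.
Qed.

(* Encodes the residues of x modulo p, ..., p ^ k in such a way that comparing
   codes at level k decides the comparison at all deeper levels. *)
Fixpoint rcode (b k : nat) x : nat :=
  if k is k'.+1 then (rcode b k' x * p ^ k + resid k x)%N else b.

(** The last digit is below p^k, so division by p^k recovers the previous code and the last residue.
    The start [b] is a tag that will name a chart of the projective line. *)
Lemma rcode_eq (b b' k : nat) x y : vge 0 x -> vge 0 y ->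
  (rcode b k x == rcode b' k y) = (b == b') && vge k%:Z (x - y).
Proof.
move=> x0 y0.
have E j : (rcode b j.+1 x == rcode b' j.+1 y) =
    (rcode b j x == rcode b' j y) && vge (j.+1)%:Z (x - y).
  rewrite -resid_eq //=.
  have := resid_lt j.+1 x; have := resid_lt j.+1 y.
  move: (p ^ j.+1)%N (resid _ _) (resid _ _) => q r s rq sq.
  apply/eqP/andP => [H|[/eqP-> /eqP->]//].
  have := congr1 (fun m => m %/ q)%N H; have := congr1 (fun m => m %% q)%N H.
  rewrite !modnMDl !modn_small // !divnMDl ?(leq_ltn_trans _ rq) // !divn_small //.
  by rewrite !addn0 => -> ->.
elim: k => [|k IHk]; first by rewrite /= vgeB // andbT.
rewrite E IHk -andbA; congr (_ && _); apply/andP/idP => [[]//|H].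
by split=> //; apply: (vgeW H); lia.
Qed.

(** Each step appends a digit smaller than the base, so a strict inequality survives all later
    digits. *)
Lemma rcode_mono (b b' k l : nat) x y : (k <= l)%N ->
  (rcode b k x < rcode b' k y)%N -> (rcode b l x < rcode b' l y)%N.
Proof.
move=> /subnK <-; elim: (l - k)%N => // m IHm /IHm; rewrite addSn /=.
move: (rcode b _ x) (rcode b' _ y) (resid_lt (m + k).+1 x) => r s.
move: (p ^ _)%N (resid _ x) (resid _ y) => q t u tq rs.
apply: (@leq_trans (r.+1 * q)); first by rewrite mulSn addnC ltn_add2r.
by rewrite (leq_trans _ (leq_addr _ _)) // leq_mul2r rs orbT.
Qed.

End Valuation.

(** * Two by two matrices of determinant 1 *)

Section Matrices2.
Variable K : fieldType.
Implicit Types (A B : 'M[K]_2) (g h : SL2 K).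

Lemma ord2P (P : 'I_2 -> Prop) : P 0 -> P 1 -> forall i, P i.
Proof.
move=> P0 P1 [[|[|//]] lti].
  by rewrite (_ : Ordinal lti = 0) //; apply: val_inj.
by rewrite (_ : Ordinal lti = 1) //; apply: val_inj.
Qed.

Lemma sum2E (F : 'I_2 -> K) : \sum_i F i = F 0 + F 1.
Proof.
rewrite big_ord_recl big_ord_recl big_ord0 addr0; congr (F _ + F _).
exact: val_inj.
Qed.

Lemma mulmx2E A B i j : (A *m B) i j = A i 0 * B 0 j + A i 1 * B 1 j.
Proof. by rewrite mxE sum2E. Qed.

Lemma det2E A : \det A = A 0 0 * A 1 1 - A 0 1 * A 1 0.
Proof.
rewrite (expand_det_row A 0) sum2E /cofactor !det_mx11 !mxE /=.
rewrite expr0 expr1 mul1r mulN1r mulrN; congr (_ * A _ _ - _ * A _ _); exact: val_inj.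
Qed.

Lemma mxtrace2E A : \tr A = A 0 0 + A 1 1.
Proof. by rewrite /mxtrace sum2E. Qed.

Lemma mx2P A B : A 0 0 = B 0 0 -> A 0 1 = B 0 1 -> A 1 0 = B 1 0 ->
  A 1 1 = B 1 1 -> A = B.
Proof. by move=> E1 E2 E3 E4; apply/matrixP; apply: ord2P; apply: ord2P. Qed.

Definition mk2 (a b c d : K) : 'M[K]_2 :=
  \matrix_(i, j) if i == 0 then if j == 0 then a else b
                 else if j == 0 then c else d.

Lemma mk2E a b c d : (mk2 a b c d 0 0 = a) * (mk2 a b c d 0 1 = b) *
  (mk2 a b c d 1 0 = c) * (mk2 a b c d 1 1 = d).
Proof. by rewrite !mxE. Qed.

Lemma SL2_det2 g : g 0 0 * g 1 1 - g 0 1 * g 1 0 = 1.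
Proof. by rewrite -det2E SL2_det. Qed.

Lemma SL2_mulE g h i j : (g * h)%g i j = g i 0 * h 0 j + g i 1 * h 1 j.
Proof. exact: mulmx2E. Qed.

Lemma SL2_1E i j : (1%g : SL2 K) i j = (i == j)%:R.
Proof. by rewrite mxE. Qed.

Lemma SL2P g h : g 0 0 = h 0 0 -> g 0 1 = h 0 1 -> g 1 0 = h 1 0 ->
  g 1 1 = h 1 1 -> g = h.
Proof. by move=> *; apply/val_inj/mx2P. Qed.

Fact mk2_det a b c d : a * d - b * c = 1 -> \det (mk2 a b c d) == 1.
Proof. by rewrite det2E !mk2E => ->. Qed.

Definition mkSL2 a b c d (H : a * d - b * c = 1) : SL2 K := MkSL2 (mk2_det H).


Lemma SL2_invE g : (((g^-1)%g : SL2 K) 0 0 = g 1 1) * (((g^-1)%g : SL2 K) 0 1 = - g 0 1) *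
  (((g^-1)%g : SL2 K) 1 0 = - g 1 0) * (((g^-1)%g : SL2 K) 1 1 = g 0 0).
Proof.
have H : g 1 1 * g 0 0 - (- g 0 1) * (- g 1 0) = 1 by rewrite -(SL2_det2 g); ring.
suff -> : (g^-1)%g = mkSL2 H by rewrite /mkSL2 /= !mk2E.
apply: (mulgI g); rewrite mulgV.
apply: SL2P; rewrite !SL2_mulE !SL2_1E /= !mk2E ?mulr1n ?mulr0n -?(SL2_det2 g); ring.
Qed.

Lemma SL2_sqr g : SL2_mx (g * g)%g = (\tr g) *: SL2_mx g - 1%:M.
Proof.
apply: mx2P; rewrite !mxE !sum2E mxtrace2E ?mulr1n ?mulr0n -?(SL2_det2 g) /=; ring.
Qed.

End Matrices2.

(** * The tree of SL_2 *)

Section Length.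
Variables (p : nat) (K : padic_field p).
Local Notation v := (@pf_val p K).
Local Notation vge := (val_ge v).
Implicit Types (g h : SL2 K) (i j : 'I_2).

Lemma ell_spec g : {N : nat | forall m : nat,
  (N <= m)%N <-> forall i j, vge (- m%:Z) (g i j)}.
Proof.
have gE : exists N : nat, [forall i, forall j, vge (- N%:Z) (g i j)].
  have /choice[N NP] : forall ij : 'I_2 * 'I_2, exists N : nat, vge (- N%:Z) (g ij.1 ij.2).
    by move=> ij; exact: vge_ex.
  exists (\max_ij N ij)%N; apply/forallP => i; apply/forallP => j.
  apply: (vgeW (NP (i, j))); rewrite lerN2 lez_nat; exact: (leq_bigmax (i, j)).
exists (ex_minn gE); case: ex_minnP => N /forallP gN min_N m.
split=> [Nm i j|gm]; first by have /forallP/(_ j)/vgeW := gN i; apply; lia.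
by apply: min_N; apply/forallP => i; apply/forallP => j.
Qed.

(* Half of the distance by which g moves the base vertex of the tree of SL_2. *)
Definition ell g : nat := sval (ell_spec g).

Lemma ell_leP g (N : nat) : reflect (forall i j, vge (- N%:Z) (g i j)) (ell g <= N)%N.
Proof. by apply: (iffP idP) => /(svalP (ell_spec g) N). Qed.

Lemma ellP g i j : vge (- (ell g)%:Z) (g i j).
Proof. by move: i j; apply/ell_leP. Qed.

Lemma ell_inv g : ell (g^-1)%g = ell g.
Proof.
have H h : (ell (h^-1)%g <= ell h)%N.
  apply/ell_leP; apply: ord2P; apply: ord2P; rewrite SL2_invE ?vgeN; exact: ellP.
by apply/eqP; rewrite eqn_leq H -{1}(invgK g) H.
Qed.

Lemma ell_mul g h : (ell (g * h)%g <= ell g + ell h)%N.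
Proof.
apply/ell_leP => i j; rewrite SL2_mulE PoszD opprD.
by apply: vgeD; apply: vgeM; exact: ellP.
Qed.

Lemma ell_eq0P g : reflect (forall i j, vge 0 (g i j)) (ell g == 0%N).
Proof. by rewrite -leqn0; apply: (iffP (ell_leP g 0)); rewrite oppr0. Qed.

Lemma ell_sign g h : eq_upto_sign g h -> ell g = ell h.
Proof.
have H x y : eq_upto_sign x y -> (ell x <= ell y)%N.
  move=> /orP[]/eqP xy; apply/ell_leP => i j; rewrite xy ?mxE ?vgeN; exact: ellP.
by move=> gh; apply/eqP; rewrite eqn_leq !H // eq_upto_sign_sym.
Qed.

(** Cayley-Hamilton gives g = (g^2 + 1) / tr g. If g^2 were not longer than g, dividing by a trace
    of negative valuation would put all entries of g in p^(1 - ell g), against the minimality of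
    [ell g], or against determinant 1 when [ell g] is 0. *)
Lemma ell_sqr g : ~~ vge 0 (\tr g) -> (ell g < ell (g * g)%g)%N.
Proof.
move=> trg; rewrite ltnNge; apply/negP => /ell_leP gg.
have t0 : \tr g != 0 by apply: contraNneq trg => ->; rewrite vge_0.
have vt : v (\tr g) <= -1 by move: trg; rewrite vgeE //; lia.
have H i j : vge (- (ell g)%:Z + 1) (g i j).
  have E : g i j = (\tr g)^-1 * ((g * g)%g i j + (i == j)%:R).
    by rewrite SL2_sqr !mxE subrK mulKf.
  rewrite E addrC; apply: vgeM; first by rewrite vgeE ?invr_eq0 // pvalV //; lia.
  by apply: vgeD => //; apply: (vgeW (vge_nat _ _)); lia.
have [l0|l0] := posnP (ell g); last first.
  suff : (ell g <= (ell g).-1)%N by rewrite leqNgt prednK // leqnn.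
  by apply/ell_leP => i j; apply: (vgeW (H i j)); lia.
have := SL2_det2 g => D; have : vge 1 1.
  rewrite -D; apply: vgeB; apply: (vgeW (vgeM (H _ _) (H _ _))); lia.
by rewrite vgeE ?oner_eq0 // pval1.
Qed.

(* The length of the common part of the paths from the base vertex o to g o
   and h o. *)
Definition overlap g h : nat := (ell g + ell h - ell (g^-1 * h)%g)%N.

Local Notation s g i j := (p%:R ^+ ell g * g i j).

Lemma s_int g i j : vge 0 (s g i j).
Proof. by rewrite vge_pM sub0r; exact: ellP. Qed.

Lemma s_prim g : exists i j, ~~ vge 1 (s g i j).
Proof.
apply: contrapT => H.
have {}H i j : vge (1 - (ell g)%:Z) (g i j).
  rewrite -vge_pM; apply/negPn/negP => nij; apply: H; by exists i, j.
have [l0|l0] := posnP (ell g); last first.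
  suff : (ell g <= (ell g).-1)%N by rewrite leqNgt prednK // leqnn.
  by apply/ell_leP => i j; apply: (vgeW (H i j)); lia.
have := SL2_det2 g => D; have : vge 1 1.
  rewrite -D; apply: vgeB; apply: (vgeW (vgeM (H _ _) (H _ _))); lia.
by rewrite vgeE ?oner_eq0 // pval1.
Qed.

Definition pcol g : 'I_2 := if vge 1 (s g 0 0) && vge 1 (s g 1 0) then 1 else 0.

Lemma pcol_prim g : ~~ vge 1 (s g 0 (pcol g)) || ~~ vge 1 (s g 1 (pcol g)).
Proof.
rewrite /pcol -negb_and; case: ifP => [/andP[s0 s1]|->//].
apply/negP => /andP[s0' s1']; have [i [j]] := s_prim g.
by move: i j; apply: ord2P; apply: ord2P; rewrite ?s0 ?s1 ?s0' ?s1'.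
Qed.

Definition cdet g i h j : K := s g 0 i * s h 1 j - s g 1 i * s h 0 j.

Lemma cdet_antisym g i h j : cdet g i h j = - cdet h j g i.
Proof. by rewrite /cdet; ring. Qed.

(** The scaled matrix has determinant p^(2 ell g), so modulo this power its columns define a single
    point of the projective line. *)
Lemma cdet_self g i j : vge (2 * ell g)%N%:Z (cdet g i g j).
Proof.
have -> : cdet g i g j = p%:R ^+ (2 * ell g) * (j%:R - i%:R).
  have e1 : (nat_of_ord (1 : 'I_2)%R)%:R = g 0 0 * g 1 1 - g 0 1 * g 1 0 by rewrite SL2_det2.
  have e0 : (nat_of_ord (0 : 'I_2)%R)%:R = 0 :> K by [].
  rewrite mul2n -addnn exprD /cdet; move: i j.
  by apply: ord2P; apply: ord2P; rewrite ?e1 ?e0; ring.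
by rewrite vge_pM subrr; apply: vgeB; apply: vge_nat.
Qed.

(** The inverse of g is its adjugate, so the entries of p^(ell g + ell h) g^-1 h are, up to sign,
    the four determinants [cdet]. *)
Lemma vge_overlap g h (k : nat) : (k <= ell g + ell h)%N ->
  (k <= overlap g h)%N <-> (forall i j, vge k%:Z (cdet g i h j)).
Proof.
move=> kle; have le := ell_mul (g^-1)%g h; rewrite ell_inv in le.
have -> : (k <= overlap g h)%N = (ell (g^-1 * h)%g <= ell g + ell h - k)%N.
  by rewrite /overlap; move: (ell (g^-1 * h)%g) le => m le; apply/idP/idP; lia.
have E i j : vge (- (ell g + ell h - k)%N%:Z) ((g^-1 * h)%g i j) =
    vge k%:Z (p%:R ^+ (ell g + ell h) * (g^-1 * h)%g i j).
  by rewrite vge_pM; congr vge; lia.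
split=> [/ell_leP H|H].
  apply: ord2P; apply: ord2P.
  - by have := H 1 0; rewrite E SL2_mulE !SL2_invE exprD; congr vge; rewrite /cdet; ring.
  - by have := H 1 1; rewrite E SL2_mulE !SL2_invE exprD; congr vge; rewrite /cdet; ring.
  - have := H 0 0; rewrite E -vgeN SL2_mulE !SL2_invE exprD; congr vge; rewrite /cdet; ring.
  - have := H 0 1; rewrite E -vgeN SL2_mulE !SL2_invE exprD; congr vge; rewrite /cdet; ring.
apply/ell_leP; apply: ord2P; apply: ord2P; rewrite E.
- have := H 1 0; rewrite -vgeN SL2_mulE !SL2_invE exprD; congr vge; rewrite /cdet; ring.
- have := H 1 1; rewrite -vgeN SL2_mulE !SL2_invE exprD; congr vge; rewrite /cdet; ring.
- have := H 0 0; rewrite SL2_mulE !SL2_invE exprD; congr vge; rewrite /cdet; ring.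
- have := H 0 1; rewrite SL2_mulE !SL2_invE exprD; congr vge; rewrite /cdet; ring.
Qed.

(* The relation [det(q, r) x + det(r, x) q + det(x, q) r = 0] for vectors of
   the plane, where x is primitive. *)
Lemma cdet_transfer g h h' j j' (k : nat) :
  vge k%:Z (cdet g (pcol g) h j) -> vge k%:Z (cdet g (pcol g) h' j') ->
  vge k%:Z (cdet h j h' j').
Proof.
move=> H H'.
have E i : vge k%:Z (s g i (pcol g) * cdet h j h' j').
  have -> : s g i (pcol g) * cdet h j h' j' =
     s h i j * cdet g (pcol g) h' j' - s h' i j' * cdet g (pcol g) h j.
    by rewrite /cdet; move: i; apply: ord2P; ring.
  by apply: vgeB; apply: vgeM0 => //; exact: s_int.
have /orP[u|u] := pcol_prim g.
  by rewrite -(vge_unitM _ _ (s_int _ _ _) u).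
by rewrite -(vge_unitM _ _ (s_int _ _ _) u).
Qed.

(** Up to level 2 ell all columns of a scaled matrix are multiples of the primitive one, so one
    determinant decides. *)
Lemma overlap_pcol g h (k : nat) : (k <= 2 * ell g)%N -> (k <= 2 * ell h)%N ->
  (k <= overlap g h)%N = vge k%:Z (cdet g (pcol g) h (pcol h)).
Proof.
move=> kg kh; apply/idP/idP => [/vge_overlap|H]; first by apply; lia.
have S x i j : (k <= 2 * ell x)%N -> vge k%:Z (cdet x i x j).
  by move=> kx; apply: (vgeW (cdet_self x i j)); lia.
apply/vge_overlap => [|i j]; first by lia.
apply: cdet_transfer (S _ _ _ kg) _; rewrite cdet_antisym vgeN.
by apply: cdet_transfer (S _ _ _ kh) _; rewrite cdet_antisym vgeN.
Qed.

(* Encodes the k-th vertex on the path from o to g o, which is the class of a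
   primitive column of the scaled matrix of g in the projective line over Z/p^k. *)
Definition code (k : nat) g : nat :=
  let x := s g 0 (pcol g) in let y := s g 1 (pcol g) in
  if vge 1 y then rcode 1 k (y / x) else rcode 0 k (x / y).

(** Whether y is a unit depends only on the point modulo p, so for k > 0 points in different charts
    differ. Within a chart the determinant is a unit times the difference of the coordinates. *)
Lemma code_eq g h (k : nat) : (0 < k)%N -> (k <= 2 * ell g)%N -> (k <= 2 * ell h)%N ->
  (code k g == code k h) = (k <= overlap g h)%N.
Proof.
move=> k0 kg kh; rewrite overlap_pcol // /code /cdet.
have := pcol_prim g; have := pcol_prim h.
move: (s_int g 0 (pcol g)) (s_int g 1 (pcol g)) (s_int h 0 (pcol h)) (s_int h 1 (pcol h)).
move: (s g 0 _) (s g 1 _) (s h 0 _) (s h 1 _) => x y x' y' x0 y0 x'0 y'0.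
have I a b : vge 0 a -> vge 0 b -> ~~ vge 1 b -> vge 0 (a / b).
  by move=> a0 b0 b1; apply: vgeM0 => //; exact: vge_unitV.
have [y'1|y'1] := boolP (vge 1 y'); have [y1|y1] := boolP (vge 1 y) => /=;
  rewrite ?orbF ?orbT => ux' ux;
  rewrite rcode_eq ?I //=.
- rewrite -(vge_unitM _ _ x0 ux) -(vge_unitM _ _ x'0 ux') -vgeN.
  by congr vge; field; rewrite !unit_neq0.
- apply/esym/negP => /vgeW-/(_ 1 k0) H; move/negP: ux'; apply.
  rewrite -(vge_unitM _ _ y0 y1) -[_ * _](subKr (x * y')); apply: vgeB => //.
  exact: vgeM0.
- apply/esym/negP => /vgeW-/(_ 1 k0) H; move/negP: ux; apply.
  rewrite -(vge_unitM _ _ y'0 y'1) mulrC -[_ * _](subrK (y * x')); apply: vgeD => //.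
  exact: vgeM0r.
- rewrite -(vge_unitM _ _ y0 y1) -(vge_unitM _ _ y'0 y'1).
  by congr vge; field; rewrite !unit_neq0.
Qed.

Lemma code_mono g h (k l : nat) : (k <= l)%N ->
  (code k g < code k h)%N -> (code l g < code l h)%N.
Proof.
by rewrite /code; case: ifP => _; case: ifP => _; exact: rcode_mono.
Qed.

Lemma overlapC g h : overlap g h = overlap h g.
Proof.
by rewrite /overlap addnC -[(h^-1 * g)%g]invgK ell_inv invgM invgK.
Qed.

Lemma overlap_le g h : (overlap g h <= 2 * ell g)%N.
Proof.
have := ell_mul g (g^-1 * h)%g; rewrite mulVKg /overlap; move: (ell (_ * _)%g) => m; lia.
Qed.

Lemma ell_mulE g h : (ell (g * h)%g + overlap (g^-1)%g h = ell g + ell h)%N.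
Proof. by have := ell_mul g h; rewrite /overlap invgK ell_inv; move: (ell (g * h)%g) => m; lia. Qed.

(** This is the 0-hyperbolicity of the tree: sharing the vertex at depth k is equality of codes,
    which is transitive. *)
Lemma overlap_trans g h x : (minn (overlap g h) (overlap h x) <= overlap g x)%N.
Proof.
have := overlap_le g h; have := overlap_le h x; have := overlap_le h g; have := overlap_le x h.
rewrite (overlapC x) (overlapC h g); set k := minn _ _ => *.
have [->//|k0] := posnP k.
rewrite -code_eq //; try lia.
have /eqP-> : code k g == code k h by rewrite code_eq //; lia.
by rewrite code_eq //; lia.
Qed.

Lemma overlap_isosceles g h x : (overlap g h < overlap h x)%N -> overlap g x = overlap g h.
Proof.
move=> lt; have := overlap_trans g h x; have := overlap_trans g x h.
rewrite (overlapC x h); lia.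
Qed.

(** The path from o to g o, of length 2 ell g, is cut at the point where the way to g x o branches
    off; translation by g^-1 turns the piece seen from g o into the second overlap. *)
Lemma overlap_mull g x : (overlap (g * x)%g g + overlap (g^-1)%g x = 2 * ell g)%N.
Proof.
have := ell_mulE g x; have := ell_mul (g * x)^-1%g g.
rewrite /overlap invgK invgM -mulgA mulVg mulg1 -invgM !ell_inv; move: (ell (g * x)%g) => m; lia.
Qed.

End Length.

(** * Evaluation of words in a group *)

Section Evaluation.
Local Open Scope group_scope.
Variables (n : nat) (H : groupType).
Implicit Types (t : 'I_n -> H) (a b : letter n) (w : seq (letter n)).

Definition evl t a : H := if a.2 then (t a.1)^-1 else t a.1.
Definition evs t w : H := foldr (fun a x => evl t a * x) 1 w.

Lemma evl_inv t a : evl t (linv a) = (evl t a)^-1.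
Proof. by rewrite /evl /=; case: a.2; rewrite ?invgK. Qed.

Lemma evs1 t a : evs t [:: a] = evl t a.
Proof. exact: mulg1. Qed.

Lemma evs_cat t u w : evs t (u ++ w) = evs t u * evs t w.
Proof. by elim: u => [|a u IHu] /=; rewrite ?mul1g // IHu mulgA. Qed.

Lemma evs_rcons_red t a w : evs t (rcons_red a w) = evl t a * evs t w.
Proof.
by case: w => //= b w; case: eqP => //= ->; rewrite evl_inv mulVKg.
Qed.

Lemma evs_rcat t u w : evs t (rcat u w) = evs t u * evs t w.
Proof. by elim: u => [|a u IHu] /=; rewrite ?mul1g // evs_rcons_red IHu mulgA. Qed.

End Evaluation.

Lemma linv_neq n (a : letter n) : linv a != a.
Proof. by case: a => i []; rewrite /linv xpair_eqE eqxx. Qed.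

Lemma letter_eq_linv n (a b : letter n) : a != b -> a.1 = b.1 -> a = linv b.
Proof.
case: a b => i d [j e] /= + ij; rewrite ij => ab.
by case: d e ab => -[]; rewrite ?eqxx.
Qed.

Definition upd n (T : Type) (t : 'I_n -> T) (i : 'I_n) (x : T) : 'I_n -> T :=
  fun j => if j == i then x else t j.

(** * Nielsen reduction *)

(* Abstracting the terms first identifies instances of the group operations
   that are only convertible, which lia would treat as distinct. *)
Ltac length_lia :=
  repeat match goal with
  | |- context [ell ?x] => let m := fresh "m" in move: (ell x) => m
  | |- context [overlap ?x ?y] => let m := fresh "m" in move: (overlap x y) => m
  end; lia.

Section Nielsen.
Local Open Scope group_scope.
Variables (p : nat) (K : padic_field p) (n : nat).
Local Notation vge := (val_ge (@pf_val p K)).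
Implicit Types (g : 'I_n -> SL2 K) (a b s t : letter n) (w : seq (letter n)) (x : SL2 K).

(** In a product t^-1 a b the two cancellations leave a middle part of the path of a. By induction,
    the path of a reduced word therefore leaves that of any letter other than its first one exactly
    where the path of its first letter does. *)
Lemma reduced_ell_gt0 g :
  (forall t a b, t != a -> b != linv a ->
    (overlap (evl g t) (evl g a) + overlap (evl g a)^-1 (evl g b) < 2 * ell (evl g a))%N) ->
  forall w, reduced w -> w != [::] -> (0 < ell (evs g w))%N.
Proof.
move=> N2.
have Q w a : reduced (a :: w) ->
    (forall t, t != a -> overlap (evs g (a :: w)) (evl g t) = overlap (evl g a) (evl g t)) /\
    (0 < overlap (evs g (a :: w)) (evl g a))%N.
  elim: w a => [|b w IHw] a aw.
    split=> [t _|] /=; rewrite mulg1 //.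
    (* This instance serves only to show that the letter has positive length. *)
    have := N2 (linv a) a a (linv_neq a); rewrite eq_sym linv_neq => /(_ isT).
    by rewrite /overlap mulVg; have -> : ell (1 : SL2 K) = 0%N; [|lia]; apply/eqP/ell_eq0P => i j;
       rewrite SL2_1E vge_nat.
  have /andP[ba bw] : (b != linv a) && reduced (b :: w) by [].
  have [IH _] := IHw _ bw.
  have E : (overlap (evs g [:: a, b & w]) (evl g a) + overlap (evl g a)^-1 (evl g b)
      = 2 * ell (evl g a))%N.
    rewrite -(overlap_mull _ (evs g (b :: w))) /=; congr (_ + _)%N.
    by rewrite overlapC [RHS]overlapC -evl_inv IH // eq_sym.
  split=> [t ta|]; last by have := N2 (linv a) a b (linv_neq a) ba; lia.
  have lt : (overlap (evl g a) (evl g t) < overlap (evs g [:: a, b & w]) (evl g a))%N.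
    by have := N2 t a b ta ba; rewrite (overlapC (evl g t)); lia.
  rewrite overlapC (overlapC (evl g a)); apply: overlap_isosceles.
  by move: lt; rewrite overlapC (overlapC (evs _ _)).
case=> // a w aw _; have [_] := Q w a aw.
have := overlap_le (evs g (a :: w)) (evl g a); lia.
Qed.

Definition weight1 g := (\sum_i ell (g i))%N.
(* Two lengths can be equal after a transformation; then the codes of the
   midpoints of the paths from o to x o and to x^-1 o decide. *)
Definition tie_weight x := (code (ell x) x + code (ell x) x^-1)%N.
Definition weight2 g := (\sum_i tie_weight (g i))%N.

Lemma tie_weight_inv x : tie_weight x^-1 = tie_weight x.
Proof. by rewrite /tie_weight ell_inv invgK addnC. Qed.

Lemma sum_upd (F : SL2 K -> nat) g i x :
  (\sum_j F (upd g i x j) + F (g i) = \sum_j F (g j) + F x)%N.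
Proof.
rewrite (bigD1 i) //= [in RHS](bigD1 i) //= /upd eqxx addnAC [in RHS]addnAC.
rewrite [(F x + _)%N]addnC; congr (_ + _)%N.
by apply: eq_bigr => j /negPf->.
Qed.

Definition smaller g g' :=
  (weight1 g < weight1 g')%N || (weight1 g == weight1 g') && (weight2 g < weight2 g')%N.

Lemma smaller_upd g i x : smaller (upd g i x) g =
  (ell x < ell (g i))%N || (ell x == ell (g i)) && (tie_weight x < tie_weight (g i))%N.
Proof.
rewrite /smaller; have := sum_upd (@ell _ K) g i x; have := sum_upd tie_weight g i x.
rewrite /weight1 /weight2; lia.
Qed.

Lemma smaller_ind (P : ('I_n -> SL2 K) -> Prop) :
  (forall g, (forall g', smaller g' g -> P g') -> P g) -> forall g, P g.
Proof.
move=> IH g; have [m] := ubnP (weight1 g); elim: m g => // m IHm g gm.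
have [l] := ubnP (weight2 g); elim: l g gm => // l IHl g gm gl.
apply: IH => g' /orP[lt|/andP[/eqP eq1 lt]]; first by apply: IHm; lia.
by apply: IHl; lia.
Qed.

Definition no_smaller_move g := forall i a, a.1 != i ->
  ~~ smaller (upd g i (g i * evl g a)) g /\ ~~ smaller (upd g i (evl g a * g i)) g.

Lemma tr_inv x : \tr (SL2_mx (x^-1)%g) = \tr x.
Proof. by rewrite !mxtrace2E !SL2_invE addrC. Qed.

Section Reduced.
Variable g : 'I_n -> SL2 K.
Hypotheses (g_hyp : forall i, ~~ vge 0 (\tr (g i))) (g_min : no_smaller_move g).
Local Notation L a := (evl g a).

(** If [s] is an inverse letter, multiplying it on the right is, up to inversion, a left move on the
    generator, and both weights ignore inversion. *)
Lemma minimal_mul s t : s.1 != t.1 ->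
  (ell (L s) < ell (L s * L t)%g)%N \/
  ell (L s) = ell (L s * L t)%g /\ (tie_weight (L s) <= tie_weight (L s * L t)%g)%N.
Proof.
move=> st; suff : ~~ ((ell (L s * L t)%g < ell (L s))%N || (ell (L s * L t)%g == ell (L s)) &&
    (tie_weight (L s * L t)%g < tie_weight (L s))%N).
  by move: (ell (L s * L t)%g) (tie_weight (L s * L t)%g) => m m'; lia.
case: s st => i [] /= it.
  have ti : (linv t).1 != i by rewrite eq_sym.
  have -> : L (i, true) = (g i)^-1 by [].
  have [_] := g_min ti; rewrite smaller_upd evl_inv.
  have -> : (L t)^-1 * g i = ((g i)^-1 * L t)^-1 by rewrite invgM invgK.
  by rewrite !ell_inv !tie_weight_inv.
have ti : t.1 != i by rewrite eq_sym.
by have [+ _] := g_min ti; rewrite smaller_upd.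
Qed.

Lemma letter_sqr a : (overlap (L a) (L a)^-1 < ell (L a))%N.
Proof.
have tra : ~~ vge 0 (\tr (L a)) by rewrite /evl; case: a.2; rewrite ?tr_inv.
by have := ell_sqr tra; have := ell_mulE (L a) (L a); rewrite overlapC; length_lia.
Qed.

Lemma overlap_minimal t a : t.1 != a.1 ->
  (overlap (L t) (L a) <= ell (L a))%N /\ (overlap (L t) (L a) <= ell (L t))%N.
Proof.
move=> ta; have ta' : (linv t).1 != a.1 by []; have at' : (linv a).1 != t.1 by rewrite eq_sym.
have := minimal_mul ta'; have := minimal_mul at'.
rewrite !evl_inv; have := ell_mulE (L t)^-1 (L a); have := ell_mulE (L a)^-1 (L t).
rewrite !invgK !ell_inv (overlapC (L a)); length_lia.
Qed.

(** Otherwise t^-1 could be replaced by t^-1 a, which has the same length. The first half of its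
    path is unchanged, while its inverse now starts along the first half of a^-1 instead of that of
    a, so a larger code of a would make [tie_weight] drop. Equal codes are excluded by
    [letter_sqr]. *)
Lemma overlap_code t a : t != a -> overlap (L t) (L a) = ell (L a) ->
  (code (ell (L a)) (L a) < code (ell (L a)) (L a)^-1)%N.
Proof.
move=> ta tie; have [ta1|ta1] := eqVneq t.1 a.1.
  have tE := letter_eq_linv ta ta1.
  by move: tie; rewrite tE evl_inv overlapC => tie; have := letter_sqr a; rewrite tie ltnn.
have := letter_sqr a => sq; have l0 : (0 < ell (L a))%N by lia.
have [_ le] := overlap_minimal ta1; rewrite tie in le.
rewrite ltn_neqAle code_eq ?ell_inv ?mul2n -?addnn ?leq_addr // -ltnNge sq /=.
rewrite leqNgt; apply/negP => lt.
have := @minimal_mul (linv t) a ta1; rewrite !evl_inv.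
set S := (L t)^-1; set A := L a in tie le lt l0 sq *.
have ES := ell_mulE S A; rewrite invgK tie in ES.
have lSA : ell (S * A)%g = ell S by move: ES; length_lia.
have lS : ell S = ell (L t) by rewrite ell_inv.
rewrite lSA ltnn => -[//|[_]]; rewrite /tie_weight lSA; apply/negP; rewrite -ltnNge.
have O1 := overlap_mull S A; rewrite invgK tie in O1.
have -> : code (ell S) (S * A)%g = code (ell S) S.
  by apply/eqP; rewrite code_eq; move: O1 lSA le lS l0; length_lia.
rewrite ltn_add2l; apply: (@code_mono _ _ _ _ (ell A)); first by move: lS le; length_lia.
have SV : S^-1 = L t by exact: invgK.
have O2 := overlap_mull A^-1 (L t); rewrite invgK ell_inv (overlapC A) tie in O2.
have -> : code (ell A) S^-1 = code (ell A) A.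
  by apply/eqP; rewrite SV code_eq ?tie //; lia.
have -> // : code (ell A) (S * A)^-1 = code (ell A) A^-1.
have lSA' : ell (A^-1 * L t)%g = ell S by rewrite -SV -invgM ell_inv.
by apply/eqP; rewrite invgM SV code_eq // ?ell_inv; move: O2 lSA' lS le; length_lia.
Qed.

(** Each cancellation takes at most half of a, so a failure means that both take exactly half. Then
    [overlap_code] for a and for its inverse orders the same two midpoint codes in opposite ways. *)
Lemma minimal_N2 t a b : t != a -> b != linv a ->
  (overlap (L t) (L a) + overlap (L a)^-1 (L b) < 2 * ell (L a))%N.
Proof.
have le s c : s != c -> (overlap (L s) (L c) <= ell (L c))%N.
  move=> sc; have [E|/overlap_minimal[]//] := eqVneq s.1 c.1.
  by rewrite (letter_eq_linv sc E) evl_inv overlapC ltnW // letter_sqr.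
move=> ta ba; have le1 := le _ _ ta; have := le _ _ ba.
rewrite evl_inv ell_inv (overlapC (L a)^-1) => le2.
rewrite ltnNge; apply/negP => ge.
have tie1 : overlap (L t) (L a) = ell (L a) by move: le1 le2 ge; length_lia.
have tie2 : overlap (L b) (L (linv a)) = ell (L (linv a)).
  by rewrite evl_inv ell_inv; move: le1 le2 ge; length_lia.
have := overlap_code ta tie1; have := overlap_code ba tie2.
by rewrite evl_inv ell_inv invgK => lt /(ltn_trans lt); rewrite ltnn.
Qed.

End Reduced.

(* Nielsen's method for the action of SL_2 on its tree: as long as no element
   of the tuple is elliptic, elementary transformations decrease the weight
   until the tuple generates a group acting freely on the orbit of o. *)
Lemma nielsen_reduction (P : ('I_n -> SL2 K) -> Prop) :
  (forall g i a, a.1 != i -> P (upd g i (g i * evl g a)) -> P g) ->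
  (forall g i a, a.1 != i -> P (upd g i (evl g a * g i)) -> P g) ->
  (forall g i, vge 0 (\tr (g i)) -> P g) ->
  (forall g, (forall w, reduced w -> w != [::] -> (0 < ell (evs g w))%N) -> P g) ->
  forall g, P g.
Proof.
move=> moveR moveL elliptic free; apply: smaller_ind => g IH.
have [[i gi]|/forallNP g_hyp] := pselect (exists i, vge 0 (\tr (g i))).
  exact: elliptic gi.
have {}g_hyp i : ~~ vge 0 (\tr (g i)) by apply/negP; exact: g_hyp.
have [g_min|] := pselect (no_smaller_move g).
  by apply: free; apply: reduced_ell_gt0; exact: minimal_N2.
move=> /existsNP[i /existsNP[a /not_implyP[ai /not_andP[]/negP]]]; rewrite negbK => /IH.
  exact: moveR.
exact: moveL.
Qed.

End Nielsen.

(** * A density criterion *)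

Section Approximation.
Local Open Scope group_scope.
Variables (p : nat) (K : padic_field p).
Local Notation v := (@pf_val p K).
Local Notation vge := (val_ge v).
Implicit Types (A : set (SL2 K)) (B C g h : SL2 K).

Definition cong (k : int) C B := forall i j, vge k (C i j - B i j)%R.

Definition approx A B := forall k : nat, exists2 C, A C & cong k%:Z C B.

Lemma cong_trans k B C D : cong k B C -> cong k C D -> cong k B D.
Proof. by move=> BC CD i j; exact: vge_sub_trans (BC i j) (CD i j). Qed.

(** This makes images of congruence balls open in PSL_2: the sign needed at C is carried over to its
    neighbour D. *)
Lemma cong_sign k C C' D B : cong k D C -> eq_upto_sign C' C -> cong k C' B ->
  exists2 D', eq_upto_sign D' D & cong k D' B.
Proof.
move=> DC /orP[/eqP e|/eqP e] C'B.
  exists D; first exact: eq_upto_sign_refl.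
  by apply: cong_trans DC _ => i j; rewrite -e.
(* The sign is produced as C^-1 C', which keeps -D in SL_2 without computing a determinant. *)
have E : SL2_mx (D * (C^-1 * C')) = (- SL2_mx D)%R.
  by rewrite -[LHS]/(D *m (invmx C *m C')) e mulmxN mulVmx ?SL2_unit // mulmxN mulmx1.
exists (D * (C^-1 * C')); first by rewrite /eq_upto_sign E eqxx orbT.
apply: cong_trans C'B => i j; rewrite E e !mxE -opprD vgeN; exact: DC.
Qed.

Lemma approx_self A B : A B -> approx A B.
Proof. by move=> AB k; exists B => // i j; rewrite subrr vge_0. Qed.

Lemma approx_sub A A' B : A `<=` A' -> approx A B -> approx A' B.
Proof. by move=> AA' AB k; have [C /AA' ? ?] := AB k; exists C. Qed.

Lemma mul_subE C C' B B' i j : ((C * C')%g i j - (B * B')%g i j =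
  ((C i 0 - B i 0) * C' 0 j + B i 0 * (C' 0 j - B' 0 j)) +
  ((C i 1 - B i 1) * C' 1 j + B i 1 * (C' 1 j - B' 1 j)))%R.
Proof. by rewrite !SL2_mulE; ring. Qed.

Lemma approx_mul A A' B B' : approx A B -> approx A' B' ->
  approx [set C | exists2 a, A a & exists2 a', A' a' & C = a * a'] (B * B').
Proof.
(* Entries of B and B' have denominators at most p^N, so precision k + N in the factors yields
   precision k in the product. *)
move=> AB A'B' k; pose N := (ell B + ell B')%N.
have [C AC CB] := AB (k + N)%N; have [C' AC' C'B'] := A'B' (k + N)%N.
exists (C * C'); first by exists C => //; exists C'.
have HB i j : vge (- N%:Z) (B i j) by apply: (vgeW (ellP _ _ _)); lia.
have HC' i j : vge (- N%:Z) (C' i j).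
  rewrite -(subrK (B' i j) (C' i j)); apply: vgeD; first by apply: (vgeW (C'B' i j)); lia.
  by apply: (vgeW (ellP _ _ _)); lia.
move=> i j; rewrite mul_subE.
have E (x y : K) : vge (k + N)%N%:Z x -> vge (- N%:Z) y -> vge k%:Z (x * y)%R.
  by move=> xk yN; apply: (vgeW (vgeM xk yN)); lia.
by apply: vgeD; apply: vgeD; rewrite 1?[(B i _ * _)%R]mulrC; apply: E.
Qed.

Section Subgroup.
Variable A : set (SL2 K).
Hypotheses (A_one : A 1) (A_mul : forall B C, A B -> A C -> A (B * C))
  (A_inv : forall B, A B -> A B^-1).

Lemma approxM B C : approx A B -> approx A C -> approx A (B * C).
Proof.
by move=> hB hC; apply: approx_sub (approx_mul hB hC) => D [b Ab [c Ac ->]]; exact: A_mul.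
Qed.

Lemma subgroupX B (k : nat) : A B -> A (B ^+ k).
Proof. by move=> AB; elim: k => [|k IHk]; rewrite ?expg0 ?expgS //; exact: A_mul. Qed.

End Subgroup.

Lemma approx_conj A x B : approx [set C ^ x | C in A] (B ^ x) -> approx A B.
Proof.
move=> H; have S (y : SL2 K) : approx [set y] y by exact: approx_self.
have -> : B = x * (B ^ x) * x^-1 by rewrite conjgE mulVKg mulgK.
apply: approx_sub (approx_mul (approx_mul (S x) H) (S x^-1)).
by move=> C [c [y -> [z [w Aw <-] ->]] [y' -> ->]]; rewrite conjgE mulVKg mulgK.
Qed.

End Approximation.

Lemma negz_muln (x : int) (k : nat) : x < 0 -> x *+ (k * 2) = - (k * (2 * `|x|))%N%:Z.
Proof. by move=> x0; rewrite -mulr_natr natz; nia. Qed.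

Lemma absz_addn (z : int) (q w : nat) : 0 <= z -> `|z|%N = (q + w)%N -> z - q%:Z = w%:Z.
Proof. by lia. Qed.

Lemma negz_modn (x : int) (z : nat) : x < 0 -> x *+ 2 <= - (z %% (2 * `|x|))%N%:Z.
Proof.
move=> x0; have L0 : (0 < 2 * `|x|)%N by lia.
by have := ltn_pmod z L0; move: (_ %% _)%N => w; lia.
Qed.

(** * Approximation of unipotent matrices *)

Section Unipotents.
Variables (p : nat) (K : padic_field p).
Local Notation v := (@pf_val p K).
Local Notation vge := (val_ge v).
Implicit Types (A : set (SL2 K)) (a B C g h : SL2 K) (s t : K).

Fact upper_det s : 1 * 1 - s * 0 = 1 :> K. Proof. by ring. Qed.
Fact lower_det s : 1 * 1 - 0 * s = 1 :> K. Proof. by ring. Qed.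
Definition upper s : SL2 K := mkSL2 (upper_det s).
Definition lower s : SL2 K := mkSL2 (lower_det s).

Lemma upperD s t : upper (s + t) = (upper s * upper t)%g.
Proof. by apply: SL2P; rewrite !SL2_mulE !mk2E; ring. Qed.

Definition is_diag h (l : K) := [/\ h 0 0 = l, h 0 1 = 0, h 1 0 = 0 & h 1 1 = l^-1].

Lemma is_diag_neq0 h l : is_diag h l -> l != 0.
Proof.
move=> [h00 h01 _ h11]; have := SL2_det2 h; rewrite h00 h01 h11.
apply: contra_eq_neq => ->.
by rewrite !mul0r subr0 eq_sym oner_eq0.
Qed.

Lemma is_diagX h l (k : nat) : is_diag h l -> is_diag (h ^+ k)%g (l ^+ k).
Proof.
move=> hl; have l0 := is_diag_neq0 hl; have [h00 h01 h10 h11] := hl.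
elim: k => [|k [E00 E01 E10 E11]].
  by split; rewrite expg0 SL2_1E ?expr0 ?invr1.
by split; rewrite expgS SL2_mulE ?h00 ?h01 ?h10 ?h11 ?E00 ?E01 ?E10 ?E11
  ?mul0r ?mulr0 ?addr0 ?add0r ?exprS ?invfM.
Qed.

Lemma is_diagV h l : is_diag h l -> is_diag (h^-1)%g l^-1.
Proof. by move=> [h00 h01 h10 h11]; split; rewrite SL2_invE ?invrK // ?h01 ?h10 oppr0. Qed.

Lemma diag_conjE h l C : is_diag h l ->
  ((h * C * h^-1)%g 0 0 = C 0 0) * ((h * C * h^-1)%g 0 1 = l ^+ 2 * C 0 1) *
  ((h * C * h^-1)%g 1 0 = l ^- 2 * C 1 0) * ((h * C * h^-1)%g 1 1 = C 1 1).
Proof.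
move=> hl; have l0 := is_diag_neq0 hl; have [h00 h01 h10 h11] := hl.
by rewrite !SL2_mulE !SL2_invE h00 h01 h10 h11; do ![split]; field.
Qed.

(** Coordinates in the algebra spanned by [a] and 1; Cayley-Hamilton closes it under products, so a
    power of [a] is described by two numbers. *)
Definition in_span (a : SL2 K) (x y : K) C :=
  forall i j, C i j = x * a i j + y * (i == j)%:R.

Lemma in_spanM a x y x' y' C C' : in_span a x y C -> in_span a x' y' C' ->
  in_span a (x * y' + x' * y + x * x' * \tr a) (y * y' - x * x') (C * C')%g.
Proof.
move=> CE C'E i j; have D := SL2_det2 a.
(* The two sides agree only up to a multiple of det a - 1, which [ring] cannot know to vanish. *)
have E (z w : K) : (z - w = - (x * x') * (a 0 0 * a 1 1 - a 0 1 * a 1 0 - 1) \/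
    z - w = 0) -> z = w.
  by rewrite D subrr mulr0 => -[] /subr0_eq.
rewrite SL2_mulE !CE !C'E mxtrace2E.
by apply: E; move: i j; apply: ord2P; apply: ord2P; rewrite /= ?mulr1n ?mulr0n;
  solve [left; ring | right; ring].
Qed.

Lemma in_spanV a x y C : in_span a x y C -> in_span a (- x) (y + x * \tr a) (C^-1)%g.
Proof.
move=> CE i j; rewrite mxtrace2E; move: i j; apply: ord2P; apply: ord2P;
 by rewrite SL2_invE CE /= ?mulr1n ?mulr0n; ring.
Qed.

Lemma det_in_span a x y C : in_span a x y C -> y ^+ 2 + x * y * \tr a + x ^+ 2 = 1.
Proof.
move=> CE; rewrite -[RHS](SL2_det2 C) !CE mxtrace2E /= mulr1n mulr0n.
transitivity (y ^+ 2 + x * y * (a 0 0 + a 1 1) + x ^+ 2 * (a 0 0 * a 1 1 - a 0 1 * a 1 0)).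
  by rewrite SL2_det2 mulr1.
by ring.
Qed.

Lemma expg_in_span a (m : nat) : vge 0 (\tr a) ->
  exists x y, [/\ vge 0 x, vge 0 y & in_span a x y (a ^+ m)%g].
Proof.
move=> tra; elim: m => [|m [x [y [x0 y0 E]]]].
  exists 0, 1; split; rewrite ?vge_0 ?vge1 // => i j.
  by rewrite expg0 SL2_1E mul0r mul1r add0r.
have E1 : in_span a 1 0 a by move=> i j; rewrite mul1r mul0r addr0.
exists (1 * y + x * 0 + 1 * x * \tr a), (0 * y - 1 * x); split.
- by rewrite mulr0 addr0 !mul1r; apply: vgeD => //; exact: vgeM0.
- by rewrite mul0r mul1r add0r vgeN.
- by rewrite expgS; exact: in_spanM.
Qed.

(** The valuation of 2 is 1 for p = 2 and 0 otherwise; the bound 2 treats all primes alike. *)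
Lemma vge_2 : ~~ vge 2 (2%:R : K).
Proof.
have p_pr := padic_prime (pf_valP K).
have [p2|p_odd] := even_prime p_pr.
  have -> : 2%:R = p%:R :> K by congr (_ *+ _); rewrite p2.
  by rewrite vgeE ?p_neq0 // pvalp.
apply/negP => two; have two1 : vge 1 (2%:R : K) by apply: (vgeW two).
have : vge 1 (1 : K).
  have -> : 1 = p%:R - 2%:R * (p./2)%:R :> K.
    have pE : p = (1 + 2 * p./2)%N by rewrite mul2n -[LHS]odd_double_half p_odd.
    have -> : p%:R = (1 + 2 * p./2)%:R :> K by congr (_ *+ _).
    by rewrite natrD natrM addrK.
  apply: vgeB; first by rewrite vgeE ?p_neq0 // pvalp.
  by apply: vgeM0r => //; exact: vge_nat.
by rewrite vgeE ?oner_eq0 // pval1.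
Qed.

(* Some power of a is congruent to 1 to any given precision, because a generates
   a module of rank 2 over the valuation ring. *)
Lemma expg_near_1 a (e : nat) : vge 0 (\tr a) ->
  exists m x y, [/\ (0 < m)%N, vge e%:Z x, vge e%:Z y & in_span a x (1 + y) (a ^+ m)%g].
Proof.
move=> tra; have /choice[f fP] : forall m : nat, exists xy : K * K,
    [/\ vge 0 xy.1, vge 0 xy.2 & in_span a xy.1 xy.2 (a ^+ m)%g].
  by move=> m; have [x [y ?]] := expg_in_span m tra; exists (x, y).
(* Pigeonhole: p^(2e) + 1 exponents, but only p^(2e) pairs of residues. *)
pose r (m : 'I_(p ^ e * p ^ e).+1) : 'I_(p ^ e) * 'I_(p ^ e) :=
  (Ordinal (resid_lt e (f m).1), Ordinal (resid_lt e (f m).2)).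
have /injectivePn[m [m' mm' rE]] : ~~ injectiveb r.
  apply/negP => /injectiveP/leq_card; rewrite card_prod !card_ord; lia.
wlog lt : m m' mm' rE / (m < m')%N.
  move=> W; have [|le|E] := ltngtP m m'; first exact: W.
    by apply: (W m' m) => //; rewrite eq_sym.
  by move/eqP: mm'; case; exact: val_inj.
have [x0 y0 E] := fP m; have [x'0 y'0 E'] := fP m'.
have dx : vge e%:Z ((f m').1 - (f m).1).
  by rewrite -resid_eq //; move/eqP: rE => /andP[/eqP[->]].
have dy : vge e%:Z ((f m').2 - (f m).2).
  by rewrite -resid_eq //; move/eqP: rE => /andP[_ /eqP[->]].
move: (f m) (f m') x0 y0 E x'0 y'0 E' dx dy => [x y] [x' y'] /= x0 y0 E x'0 y'0 E' dx dy.
have EV := in_spanV E.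
(* The coefficients are arranged so that every summand, apart from the 1, contains x' - x or y' - y,
   both divisible by p^e. *)
have V : in_span a ((x' - x) * (y + x * \tr a) + - x * (y' - y) + (x' - x) * - x * \tr a)
    (1 + ((y' - y) * (y + x * \tr a) - (x' - x) * - x)) (a ^+ (m' - m))%g.
  have -> : (a ^+ (m' - m) = a ^+ m' * (a ^+ m)^-1)%g by rewrite expgnFr // ltnW.
  have D := det_in_span E.
  have := in_spanM E' EV; rewrite /in_span => H i j; rewrite H.
  have -> : (x' * (y + x * \tr a) + - x * y' + x' * - x * \tr a) =
     (x' - x) * (y + x * \tr a) + - x * (y' - y) + (x' - x) * - x * \tr a by ring.
  have -> // : y' * (y + x * \tr a) - x' * - x =
     1 + ((y' - y) * (y + x * \tr a) - (x' - x) * - x).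
  by rewrite -D; ring.
have w0 : vge 0 (y + x * \tr a) by apply: vgeD => //; exact: vgeM0.
exists (m' - m)%N; do 2![eexists]; split; last exact: V; first by rewrite subn_gt0.
- do ![apply: vgeD]; first exact: vgeM0r.
    by apply: vgeM0 => //; rewrite vgeN.
  by apply: vgeM0r => //; apply: vgeM0r => //; rewrite vgeN.
- by apply: vgeB; apply: vgeM0r; rewrite ?vgeN.
Qed.

Lemma vge_2D (y : K) : vge 2 y -> ~~ vge 2 (2%:R + y).
Proof. by move=> y2; apply: contra vge_2 => H; rewrite -(addrK y 2%:R); exact: vgeB. Qed.

Lemma det_in_span1 a (x y : K) C : in_span a x (1 + y) C ->
  y * (2%:R + y) = - x * ((1 + y) * \tr a + x).
Proof.
move=> CE.
transitivity ((1 + y) ^+ 2 + x * (1 + y) * \tr a + x ^+ 2 - 1 - x * ((1 + y) * \tr a + x)).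
  by ring.
by rewrite (det_in_span CE); ring.
Qed.

Lemma det_in_span_bound a (x y : K) C : in_span a x (1 + y) C -> vge 0 (\tr a) ->
  vge 0 x -> vge 2 y -> vge (v x - 1) y.
Proof.
move=> CE tra x0 y2; have [->|yn0] := eqVneq y 0; first exact: vge_0.
have nz := vge_2D y2.
have n0 : 2%:R + y != 0 by apply: contraNneq nz => ->; exact: vge_0.
have : vge (v x) (y * (2%:R + y)).
  rewrite (det_in_span1 CE); apply: vgeM0r; first by rewrite vgeN /val_ge lexx orbT.
  apply: vgeD => //; apply: vgeM0 => //; apply: vgeD; first exact: vge1.
  exact: vgeW y2 _.
rewrite !vgeE ?mulf_neq0 // pvalM //; move: nz; rewrite vgeE // -ltNge; lia.
Qed.

Lemma cong_upperX C t (m : nat) (k : int) : 0 <= k -> vge 0 t -> cong k C (upper t) ->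
  cong k (C ^+ m)%g (upper (t *+ m)).
Proof.
move=> k0 t0 Ct; elim: m => [|m IHm].
  move=> i j; rewrite expg0 SL2_1E; move: i j.
  by apply: ord2P; apply: ord2P; rewrite /= !mk2E ?subrr ?vge_0.
have U (s : K) i j : vge 0 s -> vge 0 (upper s i j).
  by move=> s0; move: i j; apply: ord2P; apply: ord2P; rewrite /= !mk2E ?vge_0 ?vge1.
have t'0 : vge 0 (t *+ m) by rewrite -mulr_natr; apply: vgeM0r => //; exact: vge_nat.
have X0 i j : vge 0 ((C ^+ m)%g i j).
  by rewrite -(subrK (upper (t *+ m) i j) (_ i j)); apply: vgeD; [apply: vgeW (IHm i j) _|exact: U].
move=> i j; rewrite expgS mulrS upperD mul_subE.
have H i' : vge k ((C i i' - upper t i i') * (C ^+ m)%g i' j +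
    upper t i i' * ((C ^+ m)%g i' j - upper (t *+ m) i' j)).
  by apply: vgeD; [exact: vgeM0r|apply: vgeM0; rewrite ?U].
exact: vgeD.
Qed.

Section UpperUnipotents.
Variables (A : set (SL2 K)) (h a : SL2 K) (l : K).
Hypotheses (A_mul : forall B C, A B -> A C -> A (B * C)%g)
  (A_inv : forall B, A B -> A (B^-1)%g) (A_h : A h) (A_a : A a).
Hypotheses (hl : is_diag h l) (vl : v l < 0) (tra : vge 0 (\tr a))
  (a_inf : forall k : nat, (0 < k)%N -> (a ^+ k)%g != 1%g) (a01 : a 0 1 != 0).

Let A_one : A 1%g. Proof. by rewrite -(mulgV h); apply: A_mul => //; exact: A_inv. Qed.

Let l0 : l != 0. Proof. exact: is_diag_neq0 hl. Qed.

(* Conjugating a power a^m close to 1 by h^k contracts the lower left entry and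
   expands the upper right one to a prescribed size, so that an integer power of
   the result approximates any given upper unipotent matrix. *)
Lemma approx_upper_small s : vge (- (v l *+ 2)) s -> approx A (upper s).
Proof.
move=> sL r; pose L := `|v l|%N; pose N := (ell a + `|v (a 0%R 1%R)|)%N.
(* In the precision, [N] absorbs the denominators of [a] and the valuation of [a 0 1]; the extra 2
   makes 2 + y nonzero, so that x = 0 would force a^m = 1. *)
have [m [x [y [m0 xe ye E]]]] := expg_near_1 (r + N + 2) tra.
have y2 : vge 2 y by apply: (vgeW ye); lia.
have x0 : x != 0.
  apply: contraNneq (a_inf m0) => x0; rewrite x0 in E.
  have y0 : y = 0.
    have /eqP := det_in_span1 E; rewrite oppr0 mul0r mulf_eq0 => /orP[/eqP//|/eqP two_y].
    by have := vge_2D y2; rewrite two_y vge_0.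
  by apply/eqP; apply: SL2P; rewrite E SL2_1E y0 mul0r add0r addr0 mul1r.
have y_small : vge (v x - 1) y.
  by apply: det_in_span_bound E tra _ y2; apply: (vgeW xe).
pose z := v x + v (a 0 1).
have z0 : 0 <= z by move: xe; rewrite vgeE // /z /N; clear; lia.
(* Conjugation by h^k lowers the valuation z of the upper right entry by 2kL. This k leaves the
   remainder modulo 2L, so that v(t) < 2L and s / t is integral. *)
pose k := (`|z| %/ (2 * L))%N.
pose C := (h ^+ k * a ^+ m * (h ^+ k)^-1)%g.
have CE := diag_conjE (a ^+ m)%g (is_diagX k hl).
pose t := (l ^+ k) ^+ 2 * (x * a 0 1).
have t0 : t != 0 by rewrite !mulf_neq0 ?expf_neq0.
have vt : v t = (`|z| %% (2 * L))%N%:Z.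
  rewrite /t -exprM !pvalM ?mulf_neq0 ?expf_neq0 // pvalX //.
  have := divn_eq `|z| (2 * L); rewrite -/k -/z; move: (_ %% _)%N => w.
  have -> : v l *+ (k * 2) = - (k * (2 * L))%N%:Z.
    exact: negz_muln.
  by move/(@absz_addn z _ _ z0) => <-; rewrite addrC.
have yr : vge r%:Z y by apply: (vgeW ye); clear; lia.
have xr i j : vge r%:Z (x * a i j).
  by apply: (vgeW (vgeM xe (ellP a i j))); rewrite /N; clear; lia.
have Ct : cong (r%:Z) C (upper t).
  apply: ord2P; apply: ord2P; rewrite CE E /= !mk2E ?mulr1n ?mulr0n ?mulr1 ?mulr0 ?addr0 ?subr0.
  - by rewrite (addrC 1) addrA addrK; apply: vgeD.
  - by rewrite subrr vge_0.
  - rewrite -exprM; apply: vgeM0 => //.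
    by rewrite vgeE ?invr_eq0 ?expf_neq0 // pvalV ?expf_neq0 // pvalX // negz_muln // opprK.
  - by rewrite (addrC 1) addrA addrK; apply: vgeD.
have L0 : (0 < 2 * L)%N by rewrite /L; move: vl; clear; lia.
have tO : vge 0 t by rewrite vgeE // vt.
have /vge_nat_dense-/(_ r)[q qP] : vge 0 (s / t).
  have -> : 0 = - (v l *+ 2) + (v l *+ 2) by rewrite addNr.
  apply: vgeM => //; rewrite vgeE ?invr_eq0 // pvalV // vt.
  exact: negz_modn.
exists (C ^+ q)%g.
  apply: subgroupX => //; apply: A_mul; first apply: A_mul; last apply: A_inv;
  exact: subgroupX.
move=> i j; apply: vge_sub_trans (cong_upperX q _ tO Ct i j) _ => //.
move: i j; apply: ord2P; apply: ord2P; rewrite /= !mk2E ?subrr ?vge_0 //.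
by rewrite -[s](divfK t0) -mulr_natl -mulrBl; apply: vgeM0r => //; rewrite vge_subC.
Qed.

Lemma approx_upper s : approx A (upper s).
Proof.
have [->|s0] := eqVneq s 0; first by apply: approx_upper_small; exact: vge_0.
pose k := (`|v s| + 1)%N; pose t := l ^- (k * 2) * s.
have -> : upper s = (h ^+ k * upper t * (h ^+ k)^-1)%g.
  apply: SL2P; rewrite (diag_conjE _ (is_diagX k hl)) !mk2E ?mulr0 //.
  by rewrite /t -exprM mulVKf // expf_neq0.
have Ak : A (h ^+ k)%g by exact: subgroupX.
do ![apply: approxM => //]; [exact: approx_self| |by apply: approx_self; exact: A_inv].
apply: approx_upper_small; rewrite /t vgeE ?mulf_neq0 ?invr_eq0 ?expf_neq0 //.
rewrite pvalM ?invr_eq0 ?expf_neq0 // pvalV ?expf_neq0 // pvalX // negz_muln // opprK.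
by rewrite /k; move: (v l) (v s) vl; clear; nia.
Qed.

End UpperUnipotents.

End Unipotents.

(** * Generation by unipotents, eigenbases and transversality *)

Section Density.
Variables (p : nat) (K : padic_field p).
Local Notation v := (@pf_val p K).
Local Notation vge := (val_ge v).
Implicit Types (A : set (SL2 K)) (a B C g h x : SL2 K) (s t : K).

Fact trmx2_det g : g 0 0 * g 1 1 - g 1 0 * g 0 1 = 1.
Proof. by rewrite -(SL2_det2 g); ring. Qed.

(** Transposition reverses products, fixes diagonal matrices and exchanges the two kinds of
    unipotents, so it carries the result on [upper] over to [lower] with the same eigenvalue. *)
Definition trSL2 g : SL2 K := mkSL2 (trmx2_det g).

Lemma trSL2E g i j : trSL2 g i j = g j i.
Proof. by move: i j; apply: ord2P; apply: ord2P; rewrite /= !mk2E. Qed.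

Lemma trSL2K : involutive trSL2.
Proof. by move=> g; apply: SL2P; rewrite !trSL2E. Qed.

Lemma trSL2M g h : trSL2 (g * h)%g = (trSL2 h * trSL2 g)%g.
Proof. by apply: SL2P; rewrite !trSL2E !SL2_mulE !trSL2E; ring. Qed.

Lemma trSL2V g : trSL2 (g^-1)%g = ((trSL2 g)^-1)%g.
Proof. by apply: SL2P; rewrite !trSL2E !SL2_invE !trSL2E. Qed.

Lemma trSL2_1 : trSL2 1%g = 1%g.
Proof. by apply: SL2P; rewrite !trSL2E !SL2_1E. Qed.

Lemma trSL2X g (k : nat) : trSL2 (g ^+ k)%g = (trSL2 g ^+ k)%g.
Proof. by elim: k => [|k IHk]; rewrite ?expg0 ?trSL2_1 // expgS expgSr trSL2M IHk. Qed.

Lemma approx_tr A B : approx (trSL2 @` A) (trSL2 B) -> approx A B.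
Proof.
move=> H k; have [_ [C AC <-] CB] := H k; exists C => // i j.
by have := CB j i; rewrite !trSL2E.
Qed.

(** A matrix with nonzero lower left entry is upper times lower times upper. Otherwise
    multiplication by [lower 1] creates such an entry, because [B 1 1] cannot vanish too. *)
Lemma SL2_gen (P : SL2 K -> Prop) : (forall B C, P B -> P C -> P (B * C)%g) ->
  (forall s, P (upper s)) -> (forall s, P (lower s)) -> forall B, P B.
Proof.
move=> PM PU PL; have PB B : B 1 0 != 0 -> P B.
  move=> r0.
  pose w := (B 0 0 - 1) / B 1 0; pose z := (B 1 1 - 1) / B 1 0; pose r := B 1 0.
  have -> : B = (upper w * lower r * upper z)%g.
    have D : B 0 1 = (B 0 0 * B 1 1 - 1) / B 1 0.
      by apply: (canRL (mulfK r0)); rewrite -(SL2_det2 B); ring.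
    by apply: SL2P; rewrite !SL2_mulE !mk2E ?D /w /z /r; field.
  by apply: (PM) (PU _); apply: PM.
move=> B; have [r0|] := eqVneq (B 1 0) 0; last exact: PB.
pose r := 1 : K; have -> : B = (B * lower r * lower (- r))%g.
  by apply: SL2P; rewrite !SL2_mulE !mk2E; ring.
apply: PM => //; apply: PB; rewrite SL2_mulE !mk2E r0 mul0r add0r mulr1.
apply/eqP => E; have /eqP := SL2_det2 B.
by rewrite r0 E !mulr0 subr0 eq_sym oner_eq0.
Qed.

Section DiagonalCriterion.
Variables (A : set (SL2 K)) (h a : SL2 K) (l : K).
Hypotheses (A_mul : forall B C, A B -> A C -> A (B * C)%g)
  (A_inv : forall B, A B -> A (B^-1)%g) (A_h : A h) (A_a : A a).
Hypotheses (hl : is_diag h l) (vl : v l < 0) (tra : vge 0 (\tr a))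
  (a_inf : forall k : nat, (0 < k)%N -> (a ^+ k)%g != 1%g)
  (a01 : a 0 1 != 0) (a10 : a 1 0 != 0).

Lemma approx_diag B : approx A B.
Proof.
elim/SL2_gen: B => [B C|s|s]; first exact: approxM.
  exact: (@approx_upper p K A h a l).
apply: approx_tr.
have -> : trSL2 (lower s) = upper s by apply: SL2P; rewrite trSL2E !mk2E.
apply: (@approx_upper p K _ (trSL2 h) (trSL2 a) l) => //.
- by move=> _ _ [C AC <-] [D AD <-]; exists (D * C)%g; [exact: A_mul|exact: trSL2M].
- by move=> _ [C AC <-]; exists (C^-1)%g; [exact: A_inv|exact: trSL2V].
- by case: hl => h00 h01 h10 h11; split; rewrite trSL2E.
- by move: tra; rewrite !mxtrace2E !trSL2E.
- move=> k k0; apply: contra (a_inf k0) => /eqP E; apply/eqP/(can_inj trSL2K).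
  by rewrite trSL2X E trSL2_1.
- by rewrite trSL2E.
Qed.

End DiagonalCriterion.

(** The small root of X^2 - t X + 1 is the fixed point of u -> (1 + u^2) / t, a contraction because
    1 / t is divisible by p; [l] is its inverse. *)
Lemma hensel t : ~~ vge 0 t -> exists l, [/\ l != 0, v l < 0 & t = l + l^-1].
Proof.
move=> t_int; have t0 : t != 0 by apply: contraNneq t_int => ->; exact: vge_0.
pose s := t^-1; have s0 : s != 0 by rewrite invr_eq0.
have s1 : vge 1 s by rewrite vgeE // pvalV //; move: t_int; rewrite vgeE //; lia.
pose u := fix u (k : nat) : K := if k is k'.+1 then s * (1 + u k' ^+ 2) else 0.
have u0 k : vge 0 (u k).
  elim: k => [|k IHk] /=; first exact: vge_0.
  by apply: vgeM0r; [apply: vgeW s1 _|apply: vgeD; [exact: vge1|exact: vgeX0]].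
have uC (k : nat) : vge k%:Z (u k.+1 - u k).
  elim: k => [|k IHk]; first exact: vgeB.
  have -> : u k.+2 - u k.+1 = s * ((u k.+1 - u k) * (u k.+1 + u k)) by rewrite /=; ring.
  by apply: (vgeW (vgeM s1 (vgeM0r IHk (vgeD _ _)))) => //; lia.
have [m mP] := vge_complete uC.
have m1 : vge 1 m.
  rewrite -(subrK (u 1%N) m); apply: vgeD; first exact: mP.
  by rewrite /= expr0n addr0 mulr1.
have mE : m = s * (1 + m ^+ 2).
  apply/subr0_eq/vge_sep => k.
  have -> : m - s * (1 + m ^+ 2) = (m - u k.+1) - s * ((m - u k) * (m + u k)).
    by rewrite /=; ring.
  apply: vgeB; first by apply: (vgeW (mP _)); lia.
  apply: vgeM0; first exact: vgeW s1 _.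
  by apply: vgeM0r => //; apply: vgeD => //; apply: vgeW m1 _.
have m0 : m != 0.
  by apply: contra_eq_neq mE => ->; rewrite expr0n addr0 mulr1 eq_sym.
exists m^-1; split; rewrite ?invr_eq0 // ?invrK.
  by rewrite pvalV //; move: m1; rewrite vgeE //; lia.
apply: (mulfI m0); rewrite mulrDr divff // -expr2.
by rewrite {1}mE /s mulrAC mulVf // mul1r.
Qed.

Lemma conjSL2E g x : SL2_mx (g ^ x)%g = invmx x *m g *m x.
Proof. by rewrite conjgE mulgA. Qed.

Lemma mxtrace_conj g x : \tr (SL2_mx (g ^ x)%g) = \tr g.
Proof. by rewrite conjSL2E mxtrace_mulC mulmxA mulmxV ?SL2_unit // mul1mx. Qed.

(** The columns of the base change are multiples of the eigenvectors (l - h 1 1, h 1 0) and (l^-1 -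
    h 1 1, h 1 0), scaled to determinant 1. *)
Lemma eigenbasis_c h l : h 1 0 != 0 -> l != 0 -> l != l^-1 -> \tr h = l + l^-1 ->
  exists x, is_diag (h ^ x)%g l.
Proof.
move=> c0 l0 ll; rewrite mxtrace2E => trh; have lm : l * l - 1 != 0.
  by rewrite -(mulfV l0) -mulrBr mulf_neq0 // subr_eq0.
have Da : h 0 0 = l + l^-1 - h 1 1 by rewrite -trh addrK.
have Db : h 0 1 = ((l + l^-1 - h 1 1) * h 1 1 - 1) / h 1 0.
  by apply: (canRL (mulfK c0)); rewrite -[in RHS](SL2_det2 h) Da; ring.
have E : (l - h 1 1) / (h 1 0 * (l - l^-1)) * h 1 0 -
   (l^-1 - h 1 1) * (1 / (l - l^-1)) = 1 by field; rewrite l0 lm c0.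
have E' : l * l^-1 - 0 * 0 = 1 by rewrite divff // mul0r subr0.
exists (mkSL2 E); suff -> : (h ^ mkSL2 E)%g = mkSL2 E' by split; rewrite mk2E.
rewrite conjgE; apply: (mulgI (mkSL2 E)); rewrite mulVKg.
by apply: SL2P; rewrite !SL2_mulE !mk2E ?Da ?Db; field; rewrite ?l0 ?lm ?c0.
Qed.

Fact swap_det : 0 * 0 - 1 * (- 1) = 1 :> K. Proof. by ring. Qed.
Definition swap : SL2 K := mkSL2 swap_det.

Lemma swapE g : ((g ^ swap)%g 0 0 = g 1 1) * ((g ^ swap)%g 0 1 = - g 1 0) *
  ((g ^ swap)%g 1 0 = - g 0 1) * ((g ^ swap)%g 1 1 = g 0 0).
Proof. by rewrite conjgE !SL2_mulE !SL2_invE !mk2E; do ![split]; ring. Qed.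

Lemma eigenbasis h : ~~ vge 0 (\tr h) -> exists l x, v l < 0 /\ is_diag (h ^ x)%g l.
Proof.
move=> trh; have [l [l0 vl trE]] := hensel trh.
have ll : l != l^-1 by apply: contraTneq vl => E; have := pvalV l0; rewrite -E; lia.
exists l; suff [y y10] : exists y, (h ^ y)%g 1 0 != 0.
  have [|x xP] := eigenbasis_c y10 l0 ll; first by rewrite mxtrace_conj.
  by exists (y * x)%g; rewrite conjgM.
have [h10|h10] := eqVneq (h 1 0) 0; last by exists 1%g; rewrite conjg1.
have [h01|h01] := eqVneq (h 0 1) 0; last by exists swap; rewrite swapE oppr_eq0.
(* For diagonal h this conjugation creates the entry h 1 1 - h 0 0, which vanishes only for h = 1 or
   h = -1, where the trace is integral. *)
pose r := 1 : K; exists (lower r).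
rewrite conjgE !SL2_mulE !SL2_invE !mk2E h10 h01 /r !(mul0r, mulr0, add0r, addr0, mulr1, mul1r).
rewrite mulN1r addrC subr_eq0; apply: contra trh => /eqP E; rewrite mxtrace2E E.
have := SL2_det2 h; rewrite E h10 mulr0 subr0 => D.
suff : vge 0 (h 0 0) by move=> H; exact: vgeD.
have n0 : h 0 0 != 0 by apply: contra_eq_neq D => ->; rewrite mul0r eq_sym oner_eq0.
by have := pvalM n0 n0; rewrite D pval1 vgeE //; lia.
Qed.

(** It vanishes exactly when the matrices share an eigenvector over an algebraic closure. For
    diagonal h it is a 0 1 * a 1 0 * (h 0 0 - h 1 1)^2. *)
Definition comm_det a h := \det (a *m h - h *m a).

Lemma comm_det_conj a h x : comm_det (a ^ x)%g (h ^ x)%g = comm_det a h.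
Proof.
have X := SL2_unit x.
have E (g g' : SL2 K) : (g ^ x)%g *m (g' ^ x)%g = invmx x *m (g *m g') *m x.
  by rewrite !conjSL2E !mulmxA mulmxK // .
rewrite /comm_det !E -mulmxBl -mulmxBr !det_mulmx mulrAC -det_mulmx mulVmx //.
by rewrite det1 mul1r.
Qed.

Lemma comm_detE a h : comm_det a h = - (a 0 1 * h 1 0 - h 0 1 * a 1 0) ^+ 2 -
  ((a 0 0 - a 1 1) * h 0 1 + a 0 1 * (h 1 1 - h 0 0)) *
  ((a 1 1 - a 0 0) * h 1 0 + a 1 0 * (h 0 0 - h 1 1)).
Proof. by rewrite /comm_det det2E !mxE !sum2E; ring. Qed.

(* h is hyperbolic and fixes no point of the projective line fixed by a *)
Definition transverse a h := ~~ vge 0 (\tr h) && (comm_det a h != 0).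

Lemma transverse_conj a h x : transverse (a ^ x)%g (h ^ x)%g = transverse a h.
Proof. by rewrite /transverse mxtrace_conj comm_det_conj. Qed.

Lemma approx_transverse A a h :
  (forall B C, A B -> A C -> A (B * C)%g) -> (forall B, A B -> A (B^-1)%g) ->
  A a -> A h -> vge 0 (\tr a) -> (forall k : nat, (0 < k)%N -> (a ^+ k)%g != 1%g) ->
  transverse a h -> forall B, approx A B.
Proof.
move=> A_mul A_inv A_a A_h tra a_inf /andP[trh ah] B.
have [l [x [vl hl]]] := eigenbasis trh.
apply: (@approx_conj _ _ A x).
have := ah; rewrite -(comm_det_conj _ _ x) comm_detE.
case: (hl) => h00 -> -> h11.
rewrite !(mulr0, mul0r, subr0, sub0r, add0r, oppr0, expr0n) oppr_eq0 !mulf_eq0 !negb_or.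
move=> /andP[/andP[a01 _] /andP[a10 _]].
apply: (@approx_diag _ (h ^ x)%g (a ^ x)%g l) => //.
- by move=> _ _ [C AC <-] [D AD <-]; exists (C * D)%g; rewrite ?conjMg //; exact: A_mul.
- by move=> _ [C AC <-]; exists (C^-1)%g; rewrite ?conjVg //; exact: A_inv.
- by exists h.
- by exists a.
- by rewrite mxtrace_conj.
- by move=> k k0; rewrite -conjXg -(conj1g x) (inj_eq (conjg_inj x)) a_inf.
Qed.

End Density.

(** * Primitive pairs generating a dense subgroup *)

Section Selection.
Variables (p : nat) (K : padic_field p) (n : nat).
Local Notation v := (@pf_val p K).
Local Notation vge := (val_ge v).
Implicit Types (g : 'I_n -> SL2 K) (a b c h x : SL2 K) (i j : 'I_n) (w u : seq (letter n)).

Definition avoids i w := all (fun a : letter n => a.1 != i) w.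

Lemma evs_closed g (Q : SL2 K -> Prop) : Q 1%g -> (forall x y, Q x -> Q y -> Q (x * y)%g) ->
  (forall x, Q x -> Q (x^-1)%g) -> (forall i, Q (g i)) -> forall w, Q (evs g w).
Proof.
move=> Q1 QM QV Qg; elim=> //= a w IHw; apply: QM => //.
by rewrite /evl; case: ifP => _ //; exact: QV.
Qed.

Lemma evs_conj g x w : evs (fun i => (g i ^ x)%g) w = (evs g w ^ x)%g.
Proof.
elim: w => [|a w IHw] /=; first by rewrite conj1g.
by rewrite conjMg IHw; congr (_ * _)%g; rewrite /evl; case: ifP; rewrite ?conjVg.
Qed.

Lemma evs_nseq g (a : letter n) (k : nat) : evs g (nseq k a) = (evl g a ^+ k)%g.
Proof. by elim: k => [|k IHk]; rewrite ?expg0 // expgS /= IHk. Qed.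

Lemma vge_growth (l s t : K) : v l < 0 -> l != 0 -> s != 0 -> exists N : nat,
  forall k : nat, (N <= k)%N -> ~~ vge 0 (l ^+ k * s + l ^- k * t).
Proof.
move=> vl l0 s0; exists (`|v s| + `|v t| + 1)%N => k Nk.
have vk : v (l ^+ k) <= - k%:Z by rewrite pvalX // -mulr_natr natz; nia.
have k0 := expf_neq0 k l0.
have st : vge 0 (l ^- k * t).
  have [->|t0] := eqVneq t 0; first by rewrite mulr0 vge_0.
  by rewrite vgeE ?mulf_neq0 ?invr_eq0 // pvalM ?invr_eq0 // pvalV //; lia.
apply/negP => H; have : vge 0 (l ^+ k * s) by rewrite -(addrK (l ^- k * t) (_ * s)); exact: vgeB.
by rewrite vgeE ?mulf_neq0 // pvalM //; lia.
Qed.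

(** The sign of the exponent is chosen so that the large eigenvalue multiplies a nonzero diagonal
    entry of [c]. *)
Lemma tr_growth g j (l : K) c : is_diag (g j) l -> v l != 0 -> (c 0 0 != 0) || (c 1 1 != 0) ->
  exists (s : bool) (l' : K) (N : nat), [/\ is_diag (evl g (j, s)) l', v l' != 0 &
    forall k : nat, (N <= k)%N -> ~~ vge 0 (\tr (SL2_mx (evl g (j, s) ^+ k * c)%g))].
Proof.
move=> gl vl c01; have l0 := is_diag_neq0 gl.
have W (s : bool) (l' : K) : is_diag (evl g (j, s)) l' -> v l' != 0 ->
    (v l' < 0) && (c 0 0 != 0) || (0 < v l') && (c 1 1 != 0) ->
    exists N : nat, forall k : nat, (N <= k)%N -> ~~ vge 0 (\tr (SL2_mx (evl g (j, s) ^+ k * c)%g)).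
  move=> sl vl'; have l'0 := is_diag_neq0 sl.
  have E k : \tr (SL2_mx (evl g (j, s) ^+ k * c)%g) = l' ^+ k * c 0 0 + l' ^- k * c 1 1.
    have [D00 D01 D10 D11] := is_diagX k sl.
    by rewrite mxtrace2E !SL2_mulE D00 D01 D10 D11 !mul0r addr0 add0r.
  case/orP=> /andP[vl0 c0]; first have [N NP] := vge_growth (c 1 1) vl0 l'0 c0.
    by exists N => k /NP; rewrite E.
  have vl1 : v l'^-1 < 0 by rewrite pvalV // oppr_lt0.
  have [|N NP] := vge_growth (c 0 0) vl1 _ c0; first by rewrite invr_eq0.
  by exists N => k /NP; rewrite E addrC exprVn invrK.
have glV : is_diag (evl g (j, true)) l^-1 by exact: is_diagV.
have vlV : v l^-1 != 0 by rewrite pvalV // oppr_eq0.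
have [vl0|vl0] := ltrP (v l) 0; have [c0|c0] := eqVneq (c 0 0) 0.
- have [|||N NP] := W true l^-1 => //; last by exists true, l^-1, N.
  by move: c01; rewrite c0 eqxx /= => ->; rewrite andbT pvalV // oppr_gt0 vl0 orbT.
- by have [|||N NP] := W false l => //; [rewrite vl0 c0|exists false, l, N].
- have [|||N NP] := W false l => //; last by exists false, l, N.
  by move: c01; rewrite c0 eqxx /= => ->; rewrite andbT lt0r vl vl0 orbT.
- have [|||N NP] := W true l^-1 => //; last by exists true, l^-1, N.
  by rewrite c0 pvalV // oppr_lt0 lt0r vl vl0.
Qed.

(* Some element that completes x_i0 to part of a basis has an image transverse
   to the image of x_i0. *)
Definition selects g i0 := exists i u w, [/\ i != i0, avoids i u, avoids i w &
  transverse (g i0) (evs g u * g i * evs g w)%g].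

Lemma selects_conj g i0 x : selects (fun i => (g i ^ x)%g) i0 -> selects g i0.
Proof.
move=> [i [u [w [ii0 iu iw H]]]]; exists i, u, w; split=> //.
by rewrite -(transverse_conj _ _ x) !conjMg -!evs_conj.
Qed.

Section Diagonal.
Variables (g : 'I_n -> SL2 K) (i0 j0 : 'I_n) (l : K).
Hypotheses (gl : is_diag (g j0) l) (vl : v l != 0).
Local Notation a := (g i0).

Let l0 : l != 0. Proof. exact: is_diag_neq0 gl. Qed.

(** The sign of the exponent is fixed only by [tr_growth], so the hypothesis on [comm_det] has to
    serve every diagonal [b]. *)
Lemma selects_powers i w c : i != i0 -> i != j0 -> avoids i w ->
  c = (g i * evs g w)%g -> (c 0 0 != 0) || (c 1 1 != 0) ->
  (forall b (l' : K), is_diag b l' -> v l' != 0 -> forall N : nat,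
    exists2 k : nat, (N <= k)%N & comm_det a (b ^+ k * c)%g != 0) ->
  selects g i0.
Proof.
move=> ii0 ij iw cE c01 H.
have [s [l' [N [sl vl' NP]]]] := tr_growth gl vl c01.
have [k Nk kP] := H _ _ sl vl' N.
exists i, (nseq k (j0, s)), w; split=> //.
  by apply/allP => b /nseqP[->]; rewrite eq_sym.
by rewrite evs_nseq -mulgA -cE /transverse NP.
Qed.

(* The determinant vanishes for at most one value of k. *)
Lemma comm_det_powers c b (l' : K) (N : nat) : is_diag b l' -> v l' != 0 ->
  a 1 0 = 0 -> a 0 1 != 0 -> c 1 0 != 0 ->
  exists2 k : nat, (N <= k)%N & comm_det a (b ^+ k * c)%g != 0.
Proof.
move=> bl vl' a10 a01 c10; have l'0 := is_diag_neq0 bl.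
apply: contrapT => H; pose d := a 0 0 - a 1 1.
pose X := - a 0 1 ^+ 2 * c 1 0 + d * a 0 1 * c 1 1.
pose Y := d ^+ 2 * c 0 1 - d * a 0 1 * c 0 0.
have E (k : nat) : (N <= k)%N -> X + (l' ^+ k) ^+ 2 * Y = 0.
  move=> Nk; have : comm_det a (b ^+ k * c)%g == 0.
    by apply: contraT => nz; case: H; exists k.
  have L0 := expf_neq0 k l'0; have [D00 D01 D10 D11] := is_diagX k bl.
  (* For b^k with eigenvalue L the determinant is c 1 0 * L^-2 * (X + L^2 Y), so it vanishes only
     with the last factor. *)
  have DE : forall L : K, L != 0 ->
    - (a 0 1 * (0 * c 0 0 + L^-1 * c 1 0) - (L * c 0 1 + 0 * c 1 1) * 0) ^+ 2 -
    ((a 0 0 - a 1 1) * (L * c 0 1 + 0 * c 1 1) +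
     a 0 1 * (0 * c 0 1 + L^-1 * c 1 1 - (L * c 0 0 + 0 * c 1 0))) *
    ((a 1 1 - a 0 0) * (0 * c 0 0 + L^-1 * c 1 0) +
     0 * (L * c 0 0 + 0 * c 1 0 - (0 * c 0 1 + L^-1 * c 1 1))) =
    (L^-1 * c 1 0) * (L^-1 * (X + L ^+ 2 * Y)).
    by move=> L LL; rewrite /X /Y /d; field.
  rewrite comm_detE !SL2_mulE D00 D01 D10 D11 a10 DE //.
  by rewrite !mulf_eq0 !invr_eq0 (negPf L0) (negPf c10) => /eqP.
have Y0 : Y = 0.
  have := E N (leqnn _); have := E N.+1 (leqnSn _) => E1 E2.
  have /eqP : (l' ^+ N) ^+ 2 * Y * (1 - l' ^+ 2) = 0.
    transitivity ((X + (l' ^+ N) ^+ 2 * Y) - (X + (l' ^+ N.+1) ^+ 2 * Y)).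
      by rewrite (exprS l' N); ring.
    by rewrite E1 E2 subrr.
  rewrite mulf_eq0 mulf_eq0 (negPf (expf_neq0 2 (expf_neq0 N l'0))) /= => /orP[/eqP//|/eqP/subr0_eq l21].
  have := pvalX 2 l'0; rewrite -l21 pval1 => /esym/eqP; rewrite mulrn_eq0 /=.
  by rewrite (negPf vl').
have X0 : X = 0 by have := E N (leqnn _); rewrite Y0 mulr0 addr0.
(* Together, X = 0 and Y = 0 say that d times the right column of c is a 0 1 times the left one,
   which would make c singular. *)
have e1 : d * c 1 1 = a 0 1 * c 1 0.
  apply: (mulfI a01); apply/eqP; rewrite -subr_eq0 -X0; apply/eqP; rewrite /X; ring.
have [d0|d0] := eqVneq d 0.
  move/eqP: e1; rewrite d0 mul0r eq_sym mulf_eq0 (negPf a01) (negPf c10) //.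
have e2 : d * c 0 1 = a 0 1 * c 0 0.
  apply: (mulfI d0); apply/eqP; rewrite -subr_eq0 -Y0; apply/eqP; rewrite /Y; ring.
have : d = 0.
  rewrite -[d]mulr1 -(SL2_det2 c).
  transitivity (c 0 0 * (d * c 1 1) - (d * c 0 1) * c 1 0); first by ring.
  by rewrite e1 e2; ring.
by move/eqP; rewrite (negPf d0).
Qed.

(** The first coordinate axis is fixed by a but not by [evs g w], so some generator moves it. If the
    diagonal of that generator vanishes, multiplying by a on the right makes a diagonal entry
    nonzero. *)
Lemma selects_triangular w : a 1 0 = 0 -> a 0 1 != 0 -> evs g w 1 0 != 0 -> selects g i0.
Proof.
move=> a10 a01 w10.
have [i gi] : exists i, g i 1 0 != 0.
  apply: contrapT => H; have {}H i : g i 1 0 = 0.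
    by apply/eqP; apply: contraT => nz; case: H; exists i.
  move/eqP: w10; apply; move: w; apply: (evs_closed (Q := fun x => x 1 0 = 0)) => //.
  - by rewrite SL2_1E.
  - by move=> x y x10 y10; rewrite SL2_mulE x10 y10 mul0r mulr0 addr0.
  - by move=> x x10; rewrite SL2_invE x10 oppr0.
have ii0 : i != i0 by apply: contraNneq gi => ->; rewrite a10.
have ij : i != j0 by apply: contraNneq gi => ->; case: gl => _ _ ->.
have [gd|] := boolP ((g i 0 0 != 0) || (g i 1 1 != 0)).
  apply: (@selects_powers i [::] (g i)); rewrite /= ?mulg1 // => b l' bl vl' N.
  exact: (comm_det_powers N bl vl' a10 a01 gi).
rewrite negb_or !negbK => /andP[/eqP g00 /eqP g11].
have a00 : a 0 0 != 0.
  apply: contra_eq_neq (SL2_det2 a) => ->.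
  by rewrite a10 mul0r mulr0 subr0 eq_sym oner_eq0.
apply: (@selects_powers i [:: (i0, false)] (g i * a)%g) => //.
- by rewrite /avoids /= eq_sym ii0.
- by rewrite /= mulg1.
- by rewrite !SL2_mulE g11 mul0r addr0 mulf_neq0 ?orbT.
- move=> b l' bl vl' N; apply: comm_det_powers bl vl' _ _ _ => //.
  by rewrite SL2_mulE a10 mulr0 addr0 mulf_neq0.
Qed.

(** For diagonal a the determinant is a nonzero multiple of c 0 1 * c 1 0, whatever the power of b.
    If no single generator has suitable entries, each is triangular or antidiagonal, and a product
    of two of them works. *)
Lemma selects_diagonal w : a 0 1 = 0 -> a 1 0 = 0 -> a 0 0 != a 1 1 ->
  (forall r s : 'I_2, evs g w r s != 0) -> selects g i0.
Proof.
move=> a01 a10 aN w0.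
pose good_entries c := [/\ c 0 1 != 0, c 1 0 != 0 & (c 0 0 != 0) || (c 1 1 != 0)].
suff [i [u [c [ii0 ij iu cE [c01 c10 c00]]]]] : exists i u c,
    [/\ i != i0, i != j0, avoids i u, c = (g i * evs g u)%g & good_entries c].
  apply: (@selects_powers i u _ ii0 ij iu cE c00) => b l' bl vl' N; exists N => //.
  have L0 := expf_neq0 N (is_diag_neq0 bl); have [D00 D01 D10 D11] := is_diagX N bl.
  rewrite comm_detE a01 a10 !mul0r mulr0 subr0 expr0n oppr0 sub0r !addr0.
  rewrite !(SL2_mulE (b ^+ N)%g) D01 D10 D00 D11 !mul0r addr0 add0r.
  by rewrite oppr_eq0 !mulf_neq0 // ?invr_eq0 // subr_eq0 // eq_sym.
have nd i : (g i 0 1 != 0) || (g i 1 0 != 0) -> i != i0 /\ i != j0.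
  move=> gi; split; apply: contraTneq gi => ->; first by rewrite a01 a10 eqxx.
  by case: gl => _ -> ->; rewrite eqxx.
have [[i [g01 g10 gd]]|none] := pselect (exists i,
    [/\ g i 0 1 != 0, g i 1 0 != 0 & (g i 0 0 != 0) || (g i 1 1 != 0)]).
  have [|ii0 ij] := nd i; first by rewrite g01.
  by exists i, [::], (g i); split=> //; rewrite mulg1.
(* Otherwise all generators, hence all words, would be diagonal or antidiagonal. *)
have [i [gi0 gi1]] : exists i, ((g i 0 1 != 0) || (g i 1 0 != 0)) /\
    ((g i 0 0 != 0) || (g i 1 1 != 0)).
  apply: contrapT => H.
  have {}H i : (g i 0 1 = 0 /\ g i 1 0 = 0) \/ (g i 0 0 = 0 /\ g i 1 1 = 0).
    have [e|e] := boolP ((g i 0 1 != 0) || (g i 1 0 != 0)); last first.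
      by left; move: e; rewrite negb_or !negbK => /andP[/eqP-> /eqP->].
    have [e'|e'] := boolP ((g i 0 0 != 0) || (g i 1 1 != 0)); first by case: H; exists i.
    by right; move: e'; rewrite negb_or !negbK => /andP[/eqP-> /eqP->].
  suff [[w01 _]|[w00 _]] : (evs g w 0 1 = 0 /\ evs g w 1 0 = 0) \/
      (evs g w 0 0 = 0 /\ evs g w 1 1 = 0).
  - by have := w0 0 1; rewrite w01 eqxx.
  - by have := w0 0 0; rewrite w00 eqxx.
  move: {w0} w; apply: (evs_closed (Q := fun x => (x 0 1 = 0 /\ x 1 0 = 0) \/ (x 0 0 = 0 /\ x 1 1 = 0))) => //.
  - by left; rewrite !SL2_1E.
  - move=> x y [[x1 x2]|[x1 x2]] [[y1 y2]|[y1 y2]]; [left|right|right|left];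
    by rewrite !SL2_mulE x1 x2 y1 y2 !(mul0r, mulr0, addr0).
  - by move=> x [[x1 x2]|[x1 x2]]; [left|right]; rewrite !SL2_invE x1 x2 ?oppr0.
have [ii0 ij] := nd _ gi0.
have det0 x (r : 'I_2) : x 0 1 = 0 \/ x 1 0 = 0 -> x r r != 0.
  move=> H; have := SL2_det2 x; have -> : x 0 1 * x 1 0 = 0.
    by case: H => ->; rewrite ?mul0r ?mulr0.
  rewrite subr0 => D; move: r; apply: ord2P; apply/eqP => x0; move/eqP: D;
  by rewrite x0 ?mul0r ?mulr0 eq_sym oner_eq0.
have det1 x : x 0 0 = 0 \/ x 1 1 = 0 -> x 0 1 != 0 /\ x 1 0 != 0.
  move=> H; have := SL2_det2 x; have -> : x 0 0 * x 1 1 = 0.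
    by case: H => ->; rewrite ?mul0r ?mulr0.
  rewrite sub0r => D; split; apply/eqP => x0; move/eqP: D;
  by rewrite x0 ?mul0r ?mulr0 oppr0 eq_sym oner_eq0.
have tri i' : (g i' 0 0 != 0) || (g i' 1 1 != 0) -> g i' 0 1 = 0 \/ g i' 1 0 = 0.
  move=> gd; have [e1|e1] := eqVneq (g i' 0 1) 0; first by left.
  have [e2|e2] := eqVneq (g i' 1 0) 0; first by right.
  by case: none; exists i'.
have anti i' : (g i' 0 0 != 0) || (g i' 1 1 != 0) = false -> g i' 0 0 = 0 /\ g i' 1 1 = 0.
  by move/negbT; rewrite negb_or !negbK => /andP[/eqP-> /eqP->].
have use i' : i' != i -> good_entries (g i * g i')%g -> exists i u c,
    [/\ i != i0, i != j0, avoids i u, c = (g i * evs g u)%g & good_entries c].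
  move=> i'i c; exists i, [:: (i', false)], (g i * g i')%g; split=> //.
    by rewrite /avoids /= i'i.
  by rewrite /= mulg1.
case: (tri i gi1) => gi00.
- have gi10 : g i 1 0 != 0 by move: gi0; rewrite gi00 eqxx.
  have [i' gi'] : exists i', g i' 0 1 != 0.
    apply: contrapT => H; have {}H i' : g i' 0 1 = 0.
      by apply/eqP; apply: contraT => nz; case: H; exists i'.
    have := w0 0 1; suff -> : evs g w 0 1 = 0 by rewrite eqxx.
    move: {w0} w; apply: (evs_closed (Q := fun x => x 0 1 = 0)) => //.
    - by rewrite SL2_1E.
    - by move=> x y x1 y1; rewrite SL2_mulE x1 y1 mul0r mulr0 addr0.
    - by move=> x x1; rewrite SL2_invE x1 oppr0.
  have i'i : i' != i by apply: contraNneq gi' => ->; rewrite gi00.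
  have d0 : g i 0 0 != 0 by apply: det0 => //; left.
  have d1 : g i 1 1 != 0 by apply: det0 => //; left.
  apply: (use i' i'i); rewrite /good_entries !SL2_mulE gi00 !mul0r !addr0.
  case E : ((g i' 0 0 != 0) || (g i' 1 1 != 0)).
    have gi'10 : g i' 1 0 = 0 by case: (tri _ E) => // e; rewrite e eqxx in gi'.
    have d'0 : g i' 0 0 != 0 by apply: det0 => //; right.
    by rewrite gi'10 mulr0 addr0 !mulf_neq0.
  have [e0 e1] := anti _ E; have [] := det1 (g i'); first by left.
  by move=> _ e10; rewrite e0 e1 !mulr0 add0r addr0 !mulf_neq0 ?orbT.
- have gi01 : g i 0 1 != 0 by move: gi0; rewrite gi00 eqxx orbF.
  have [i' gi'] : exists i', g i' 1 0 != 0.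
    apply: contrapT => H; have {}H i' : g i' 1 0 = 0.
      by apply/eqP; apply: contraT => nz; case: H; exists i'.
    have := w0 1 0; suff -> : evs g w 1 0 = 0 by rewrite eqxx.
    move: {w0} w; apply: (evs_closed (Q := fun x => x 1 0 = 0)) => //.
    - by rewrite SL2_1E.
    - by move=> x y x1 y1; rewrite SL2_mulE x1 y1 mul0r mulr0 addr0.
    - by move=> x x1; rewrite SL2_invE x1 oppr0.
  have i'i : i' != i by apply: contraNneq gi' => ->; rewrite gi00.
  have d0 : g i 0 0 != 0 by apply: det0 => //; right.
  have d1 : g i 1 1 != 0 by apply: det0 => //; right.
  apply: (use i' i'i); rewrite /good_entries !SL2_mulE gi00 !mul0r !add0r.
  case E : ((g i' 0 0 != 0) || (g i' 1 1 != 0)).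
    have gi'01 : g i' 0 1 = 0 by case: (tri _ E) => // e; rewrite e eqxx in gi'.
    have d'1 : g i' 1 1 != 0 by apply: det0 => //; left.
    by rewrite gi'01 mulr0 add0r !mulf_neq0 ?orbT.
  have [e0 e1] := anti _ E; have [] := det1 (g i'); first by left.
  by move=> e01 _; rewrite e0 e1 !mulr0 add0r addr0 !mulf_neq0.
Qed.

End Diagonal.

(** In an eigenbasis of [g j0] the off-diagonal entries of the image of x_i0 decide. If both are
    nonzero, [g j0] itself is transverse; if one is, the triangular case applies, after a swap if
    necessary; if none is, the square being nontrivial keeps the matrix from being scalar. *)
Lemma selects_hyperbolic g i0 j0 : j0 != i0 -> ~~ vge 0 (\tr (g j0)) ->
  (g i0 ^+ 2)%g != 1%g ->
  (forall x, exists w, forall r s : 'I_2, (evs g w ^ x)%g r s != 0) -> selects g i0.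
Proof.
move=> ij0 trg a2 gen; have [l [x [vl gl]]] := eigenbasis trg.
apply: (@selects_conj _ _ x); set g' := fun i => _.
have [w wP] := gen x.
have {}wP (r s : 'I_2) : evs g' w r s != 0 by rewrite evs_conj.
have vl0 : v l != 0 by rewrite lt_eqF.
have a2' : (g' i0 ^+ 2)%g != 1%g by rewrite /g' -conjXg -(conj1g x) (inj_eq (conjg_inj x)).
have [a01|a01] := eqVneq (g' i0 0 1) 0; have [a10|a10] := eqVneq (g' i0 1 0) 0.
- apply: (@selects_diagonal g' i0 j0 l gl vl0 w a01 a10 _ wP).
  apply: contra a2' => /eqP E; apply/eqP; have := SL2_det2 (g' i0); rewrite E a01 mul0r subr0 => D.
  rewrite expg2; apply: SL2P; rewrite SL2_mulE SL2_1E ?E ?a01 ?a10 ?D ?mulr0 ?mul0r ?addr0 ?add0r //.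
- apply: (@selects_conj _ _ (swap K)).
  apply: (@selects_triangular (fun i => (g' i ^ swap K)%g) i0 j0 l^-1 _ _ w).
  + by case: gl => h00 h01 h10 h11; split; rewrite swapE ?h00 ?h01 ?h10 ?h11 ?oppr0 ?invrK.
  + by rewrite pvalV ?oppr_eq0 // (is_diag_neq0 gl).
  + by rewrite swapE a01 oppr0.
  + by rewrite swapE oppr_eq0.
  + by rewrite evs_conj swapE oppr_eq0.
- exact: (@selects_triangular g' i0 j0 l gl vl0 w a10 a01 (wP 1 0)).
- exists j0, [::], [::]; split=> //; rewrite /= mul1g mulg1 /transverse.
  rewrite {1}/g' mxtrace_conj trg comm_detE; case: (gl) => h00 -> -> h11.
  rewrite !(mulr0, mul0r, subr0, sub0r, add0r, oppr0, expr0n) oppr_eq0.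
  have ll : (g j0 ^ x)%g 1 1 - (g j0 ^ x)%g 0 0 != 0.
    rewrite subr_eq0 h00 h11; apply: contra vl0 => /eqP E.
    by have := pvalV (is_diag_neq0 gl); rewrite E => /eqP; lia.
  by rewrite !mulf_neq0 // -opprB oppr_eq0.
Qed.

End Selection.

(** * Boundedness from integral traces *)

Section Boundedness.
Variables (p : nat) (K : padic_field p).
Local Notation v := (@pf_val p K).
Local Notation vge := (val_ge v).
Implicit Types (x y z : SL2 K) (l : seq (SL2 K)) (X Y Z : 'M[K]_2).

(* The module spanned over the valuation ring by the products of subsequences of l. *)
Fixpoint mono_span l X : Prop :=
  if l is z :: l' then exists Y Z, [/\ mono_span l' Y, mono_span l' Z & X = Y + Z *m z]
  else exists2 r, vge 0 r & X = r%:M.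

Lemma mono_spanD l X Y : mono_span l X -> mono_span l Y -> mono_span l (X + Y).
Proof.
elim: l X Y => [|z l IHl] X Y /= => [[r r0 ->] [s s0 ->]|[X1 [X2 [h1 h2 ->]]] [Y1 [Y2 [h3 h4 ->]]]].
  by exists (r + s); [exact: vgeD|rewrite raddfD].
by exists (X1 + Y1), (X2 + Y2); split; [exact: IHl|exact: IHl|rewrite mulmxDl addrACA].
Qed.

Lemma mono_spanZ l (s : K) X : vge 0 s -> mono_span l X -> mono_span l (s *: X).
Proof.
move=> s0; elim: l X => [|z l IHl] X /= => [[r r0 ->]|[X1 [X2 [h1 h2 ->]]]].
  by exists (s * r); [exact: vgeM0|rewrite scale_scalar_mx].
by exists (s *: X1), (s *: X2); split; [exact: IHl|exact: IHl|rewrite scalerDr scalemxAl].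
Qed.

Lemma mono_span1 l : mono_span l 1%:M.
Proof.
elim: l => [|z l IHl] /=; first by exists 1; rewrite ?vge1.
exists 1%:M, 0; split; rewrite ?mul0mx ?addr0 //.
by have := mono_spanZ (vge_0 K 0) IHl; rewrite scale0r.
Qed.

Lemma mono_span_bound l : exists N : nat, forall X, mono_span l X ->
  forall i j, vge (- N%:Z) (X i j).
Proof.
elim: l => [|z l [N IHl]] /=.
  exists 0%N => _ [r r0 ->] i j; rewrite mxE oppr0.
  by case: (i == j); rewrite ?mulr1n ?mulr0n ?vge_0.
exists (N + ell z)%N => _ [Y [Z [hY hZ ->]]] i j; rewrite mxE.
apply: vgeD; first by apply: (vgeW (IHl _ hY _ _)); lia.
by rewrite mulmx2E; apply: vgeD; apply: (vgeW (vgeM (IHl _ hZ _ _) (ellP _ _ _))); lia.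
Qed.

(** Polarized Cayley-Hamilton: exchanging two factors costs a sign and shorter products. *)
Lemma SL2_anticomm x y : SL2_mx (x * y)%g = - SL2_mx (y * x)%g + (\tr x) *: SL2_mx y +
  (\tr y) *: SL2_mx x + (\tr (SL2_mx (x * y)%g) - \tr x * \tr y)%:M.
Proof.
rewrite !mxtrace2E.
apply: mx2P; rewrite !mxE !sum2E /= ?mulr1n ?mulr0n; ring.
Qed.

Lemma SL2_invmx x : SL2_mx (x^-1)%g = (\tr x)%:M - SL2_mx x.
Proof.
by apply: mx2P; rewrite SL2_invE mxE [X in _ = X + _]mxE [X in _ = _ + X]mxE mxtrace2E /=
  ?mulr1n ?mulr0n; ring.
Qed.

(** A new factor is moved to its place in the order of [l] by [SL2_anticomm], and a repeated one is
    removed by Cayley-Hamilton; the coefficients involve only traces of elements and of pairs. *)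
Lemma mono_span_mul l : (forall x, x \in l -> vge 0 (\tr x)) ->
  (forall x y, x \in l -> y \in l -> x != y -> vge 0 (\tr (SL2_mx (x * y)%g))) ->
  forall x X, x \in l -> mono_span l X -> mono_span l (X *m x).
Proof.
elim: l => [|z l IHl] // tr1 tr2 x X xl [Y [Z [hY hZ ->]]].
have z0 : vge 0 (\tr z) by apply: tr1; rewrite mem_head.
have IH u U : u \in l -> mono_span l U -> mono_span l (U *m u).
  apply: IHl => [u' u'l|u' u'' u'l u''l]; first by apply: tr1; rewrite inE u'l orbT.
  by apply: tr2; rewrite inE ?u'l ?u''l orbT.
have [xz|xz] := eqVneq x z.
  exists (-1 *: Z), (Y + (\tr z) *: Z); split.
  - by apply: mono_spanZ => //; rewrite vgeN vge1.
  - by apply: mono_spanD => //; apply: mono_spanZ.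
  rewrite xz mulmxDl -mulmxA -[SL2_mx z *m z]/(SL2_mx (z * z)%g) SL2_sqr mulmxBr mulmx1.
  rewrite mulmxDl scaleN1r -scalemxAr scalemxAl.
  by rewrite addrA addrC.
have {}xl : x \in l by move: xl; rewrite inE (negPf xz).
have x0 : vge 0 (\tr x) by apply: tr1; rewrite inE xl orbT.
have zx0 : vge 0 (\tr (SL2_mx (z * x)%g) - \tr z * \tr x).
  apply: vgeB; last exact: vgeM0.
  by apply: tr2; rewrite ?mem_head ?inE ?xl ?orbT // eq_sym.
exists (Y *m x + ((\tr z) *: (Z *m x) + (\tr (SL2_mx (z * x)%g) - \tr z * \tr x) *: Z)),
  (-1 *: (Z *m x) + (\tr x) *: Z); split.
- by apply: mono_spanD; [exact: IH|apply: mono_spanD; apply: mono_spanZ => //; exact: IH].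
- apply: mono_spanD; apply: mono_spanZ => //; last exact: IH.
  by rewrite vgeN vge1.
rewrite mulmxDl -mulmxA -[SL2_mx z *m x]/(SL2_mx (z * x)%g) [in LHS]SL2_anticomm.
rewrite !mulmxDr mulmxN -!scalemxAr mul_mx_scalar -[SL2_mx (x * z)%g]/(x *m z) mulmxA.
rewrite mulmxDl -!scalemxAl scaleN1r.
move: (Y *m x) (Z *m x *m z) (_ *: (Z *m x)) (_ *: (Z *m z)) (_ *: Z) => A B C D E.
by apply/matrixP => i j; rewrite !mxE; ring.
Qed.

Variable n : nat.
Implicit Types (g : 'I_n -> SL2 K).

Lemma evs_bounded g : (forall i, vge 0 (\tr (g i))) ->
  (forall i j, i != j -> vge 0 (\tr (SL2_mx (g i * g j)%g))) ->
  exists N : nat, forall w, (ell (evs g w) <= N)%N.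
Proof.
move=> tr1 tr2; pose l := codom g.
have gl i : g i \in l by exact: codom_f.
have mul : forall x X, x \in l -> mono_span l X -> mono_span l (X *m x).
  apply: mono_span_mul => [x /codomP[i ->]//|x y /codomP[i ->] /codomP[j ->] ij].
  by apply: tr2; apply: contraNneq ij => ->.
have [N NP] := mono_span_bound l; exists N => w; apply/ell_leP; apply: NP.
suff H X : mono_span l X -> mono_span l (X *m evs g w).
  by rewrite -[SL2_mx _]mul1mx; apply/H/mono_span1.
elim: w X => [|a w IHw] X hX /=; first by rewrite mulmx1.
rewrite mulmxA; apply: IHw; rewrite /evl; case: a.2; last exact: mul.
rewrite SL2_invmx mulmxBr mul_mx_scalar; apply: mono_spanD; first exact: mono_spanZ.
by rewrite -scaleN1r; apply: mono_spanZ; [rewrite vgeN vge1|exact: mul].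
Qed.

End Boundedness.

(** * Free factors and automorphisms of free groups *)

Section FreeGroups.
Local Open Scope group_scope.
Variable n : nat.
Local Notation F := (free_group n).
Implicit Types (x y z : F) (w : seq (letter n)) (S : {pred 'I_n}).

Section Homomorphisms.
Variable H : groupType.
Implicit Types (h : {multiplicative F -> H}) (t : 'I_n -> H).

Lemma hom1 (G1 G2 : groupType) (h : {multiplicative G1 -> G2}) : h 1 = 1.
Proof. by apply: (mulgI (h 1)); rewrite -gmulfM !mulg1. Qed.

Lemma homV (G1 G2 : groupType) (h : {multiplicative G1 -> G2}) (x : G1) : h x^-1 = (h x)^-1.
Proof. by apply: (mulgI (h x)); rewrite -gmulfM !mulgV hom1. Qed.

Definition free_lift t x : H := evs t (word x).

Lemma free_liftM t : {morph free_lift t : x y / x * y}.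
Proof. by move=> x y; exact: evs_rcat. Qed.

HB.instance Definition _ t := isMultiplicative.Build F H (free_lift t) (free_liftM t).

Lemma free_lift_gen t i : free_lift t (free_gen i) = t i.
Proof. exact: mulg1. Qed.

End Homomorphisms.

Lemma evs_hom (G1 G2 : groupType) (h : {multiplicative G1 -> G2}) (t : 'I_n -> G1) w :
  h (evs t w) = evs (h \o t) w.
Proof.
elim: w => [|a w IHw] /=; first exact: hom1.
by rewrite gmulfM IHw /evl; case: a.2; rewrite ?homV.
Qed.

Lemma free_word x : x = evs (@free_gen n) (word x).
Proof.
case: x => w wR /=; elim: w wR => [|a w IHw] wR; first exact: val_inj.
have wR' : reduced w := path_sorted wR.
rewrite /= -(IHw wR'); apply: val_inj.
have aE : word (evl (@free_gen n) a) = [:: a] by case: a {wR} => i [].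
rewrite [RHS]/= /rcat aE /=; case: w wR {IHw wR'} => //= b w /andP[/negPf ba _].
by rewrite ba.
Qed.

Lemma free_homE (H : groupType) (h : {multiplicative F -> H}) x :
  h x = evs (fun i => h (free_gen i)) (word x).
Proof. by rewrite [in LHS](free_word x) evs_hom. Qed.

Lemma free_hom_eq (H : groupType) (h h' : {multiplicative F -> H}) :
  (forall i, h (free_gen i) = h' (free_gen i)) -> h =1 h'.
Proof.
move=> hh' x; rewrite !free_homE; congr evs; exact/funext.
Qed.

Definition letters_in S : set F := [set x | all (fun a : letter n => a.1 \in S) (word x)].

Lemma letters_in_gen S i : i \in S -> letters_in S (free_gen i).
Proof. by move=> iS; rewrite /letters_in /= iS. Qed.

Lemma letters_in1 S : letters_in S 1. Proof. by []. Qed.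

Lemma letters_inM S x y : letters_in S x -> letters_in S y -> letters_in S (x * y).
Proof.
rewrite /letters_in /=; move: (word y); elim: (word x) => //= a u IHu w /andP[aS uS] wS.
have := IHu w uS wS; case: (rcat u w) => [|b w'] /=; first by rewrite aS.
by case: ifP => /=; rewrite ?aS // => _ /andP[].
Qed.

Lemma letters_inV S x : letters_in S x -> letters_in S x^-1.
Proof. by rewrite /letters_in /= /rinv all_rev all_map. Qed.

Lemma letters_in_word S w : all (fun a : letter n => a.1 \in S) w ->
  letters_in S (evs (@free_gen n) w).
Proof.
elim: w => //= a w IHw /andP[aS wS]; apply: letters_inM; last exact: IHw.
by rewrite /evl; case: a.2; [apply: letters_inV|]; exact: letters_in_gen.
Qed.

Lemma subgroupP (G : groupType) (A : set G) : A 1 -> (forall x y : G, A x -> A y -> A (x * y)) ->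
  (forall x : G, A x -> A x^-1) -> is_subgroup A.
Proof.
move=> A_1 A_M A_V; split; first exact/mem_set.
by move=> x y /set_mem Ax /set_mem Ay; apply/mem_set/A_M => //; exact: A_V.
Qed.

Lemma letters_in_subgroup S : is_subgroup (letters_in S).
Proof.
by apply: subgroupP; [exact: letters_in1|exact: letters_inM|exact: letters_inV].
Qed.

Lemma letters_in_hom (H : groupType) S (a : F -> H) (t : 'I_n -> H) :
  {in letters_in S &, {morph a : x y / x * y}} ->
  (forall i, i \in S -> t i = a (free_gen i)) ->
  {in letters_in S, a =1 free_lift t}.
Proof.
move=> aM tE x /set_mem xS.
have a1 : a 1 = 1.
  by apply: (mulgI (a 1)); rewrite -aM ?mulg1 //; apply/mem_set/letters_in1.
have aV y : letters_in S y -> a y^-1 = (a y)^-1.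
  move=> yS; apply: (mulgI (a y)); rewrite -aM ?mulgV //; apply/mem_set => //.
  exact: letters_inV.
rewrite [in LHS](free_word x) /free_lift; move: xS; rewrite /letters_in /=.
elim: (word x) => [|b w IHw] //= /andP[bS wS].
have L : letters_in S (evl (@free_gen n) b).
  by rewrite /evl; case: b.2; [apply: letters_inV|]; exact: letters_in_gen.
rewrite aM ?IHw //; last 2 first.
- exact/mem_set.
- exact/mem_set/letters_in_word.
congr (_ * _); rewrite /evl; case: b.2; rewrite ?tE //.
by rewrite aV //; exact: letters_in_gen.
Qed.

(** The complementary factor consists of the words in the letters outside [S]; x_i shows that it is
    nontrivial. *)
Lemma letters_in_free_factor S i : i \notin S -> proper_free_factor (letters_in S).
Proof.
move=> iS; split; first exact: letters_in_subgroup.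
exists (letters_in [predC S]); split; first exact: letters_in_subgroup.
  move=> H a b aM bM.
  pose t j := if j \in S then a (free_gen j) else b (free_gen j).
  exists (free_lift t); split.
  - by move=> x xS; rewrite (letters_in_hom aM (t := t)) // => j jS; rewrite /t jS.
  - move=> x xS; rewrite (letters_in_hom bM (t := t)) // => j jS; rewrite /t.
    by move: jS; rewrite inE => /negPf->.
  move=> h' ha hb; apply: free_hom_eq => j; rewrite [RHS](free_lift_gen t j) /t.
  case: ifPn => jS; first by rewrite ha //; apply/mem_set/letters_in_gen.
  by rewrite hb //; apply/mem_set/letters_in_gen; rewrite inE.
move=> E; have : letters_in [predC S] (free_gen i) by apply: letters_in_gen; rewrite inE.
by rewrite E => /(congr1 (@word n)).
Qed.

Section Automorphisms.
Variables (phi psi : {multiplicative F -> F}).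
Hypotheses (phiK : cancel phi psi) (psiK : cancel psi phi).

Lemma image_subgroup (A : set F) : is_subgroup A -> is_subgroup (phi @` A).
Proof.
move=> [A1 AD]; split; first by apply/mem_set; exists 1; [exact/set_mem|exact: hom1].
move=> _ _ /set_mem[x Ax <-] /set_mem[y Ay <-]; apply/mem_set; exists (x * y^-1).
  by apply/set_mem/AD; exact/mem_set.
by rewrite gmulfM homV.
Qed.

Lemma image_proper_free_factor (A : set F) :
  proper_free_factor A -> proper_free_factor (phi @` A).
Proof.
move=> [Ag [B [Bg AB B1]]]; split; first exact: image_subgroup.
exists (phi @` B); split; first exact: image_subgroup.
  move=> H a b aM bM; have im (C : set F) x : x \in C -> phi x \in phi @` C.
    by move=> /set_mem Cx; apply/mem_set; exists x.
  have [x y xA yA|x y xB yB|h [ha hb hU]] := AB H (a \o phi) (b \o phi).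
  - by rewrite /= gmulfM aM // im.
  - by rewrite /= gmulfM bM // im.
  exists [the {multiplicative F -> H} of h \o psi]; split.
  - by move=> _ /set_mem[x Ax <-] /=; rewrite phiK ha //; exact/mem_set.
  - by move=> _ /set_mem[x Bx <-] /=; rewrite phiK hb //; exact/mem_set.
  move=> h' h'a h'b x /=; rewrite -[in LHS](psiK x).
  apply: (hU [the {multiplicative F -> H} of h' \o phi]) => y yC /=.
    by rewrite h'a // im.
  by rewrite h'b // im.
move=> E; apply: B1; apply/seteqP; split=> x.
  move=> Bx; have : [set 1] (phi x) by rewrite -E; exists x.
  by move=> /= /(congr1 psi); rewrite phiK hom1.
move=> ->; have [x1 Bx1 E1] : (phi @` B) 1 by rewrite E.
by move: E1 => /(congr1 psi); rewrite phiK hom1 => <-.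
Qed.

(** This is the change of basis: a factor found for f o phi is moved by phi to one for f. *)
Lemma factor_image_automorphism (T : Type) (f : F -> T) (Q : set T -> Prop) :
  (exists2 A, proper_free_factor A & Q ((f \o phi) @` A)) ->
  exists2 A, proper_free_factor A & Q (f @` A).
Proof.
move=> [A Af QA]; exists (phi @` A); first exact: image_proper_free_factor.
by rewrite image_comp.
Qed.

End Automorphisms.

Lemma evs_upd_avoids (G : groupType) (t : 'I_n -> G) i (y : G) w : avoids i w ->
  evs (upd t i y) w = evs t w.
Proof.
elim: w => //= a w IHw /andP[ai iw]; rewrite IHw //; congr (_ * _).
by rewrite /evl /upd (negPf ai).
Qed.

(** If u and w avoid x_i, this is an automorphism. It covers both the Nielsen moves and the passage
    to the element found by [selects]. *)
Definition transvection i u w : F -> F := free_lift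
  (upd (@free_gen n) i (evs (@free_gen n) u * free_gen i * evs (@free_gen n) w)).

HB.instance Definition _ i u w := Multiplicative.on (transvection i u w).

Lemma avoids_rinv i w : avoids i w -> avoids i (rinv w).
Proof. by rewrite /avoids /rinv all_rev all_map. Qed.

Lemma evs_rinv (G : groupType) (t : 'I_n -> G) w : evs t (rinv w) = (evs t w)^-1.
Proof.
elim: w => [|a w IHw]; first by rewrite invg1.
by rewrite /rinv /= rev_cons -cats1 evs_cat -/(rinv w) IHw /= mulg1 evl_inv invgM.
Qed.

Lemma transvection_gen i u w j : transvection i u w (free_gen j) =
  upd (@free_gen n) i (evs (@free_gen n) u * free_gen i * evs (@free_gen n) w) j.
Proof. exact: free_lift_gen. Qed.

Lemma transvection_avoids i u w s : avoids i s ->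
  transvection i u w (evs (@free_gen n) s) = evs (@free_gen n) s.
Proof.
move=> si; rewrite evs_hom.
rewrite (_ : _ \o _ = upd (@free_gen n) i (evs (@free_gen n) u * free_gen i * evs (@free_gen n) w)).
  exact: evs_upd_avoids.
by apply/funext => j; exact: transvection_gen.
Qed.

Lemma transvectionK i u w : avoids i u -> avoids i w ->
  cancel (transvection i u w) (transvection i (rinv u) (rinv w)).
Proof.
move=> iu iw; pose h := [the {multiplicative F -> F} of
  transvection i (rinv u) (rinv w) \o transvection i u w].
suff : h =1 [the {multiplicative F -> F} of idfun] by [].
apply: free_hom_eq => j; rewrite /= transvection_gen /upd; case: eqP => [->|/eqP ji].
  have M := @gmulfM _ _ [the {multiplicative F -> F} of transvection i (rinv u) (rinv w)].
  rewrite !M /= !transvection_avoids // transvection_gen /upd eqxx !evs_rinv.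
  by rewrite !mulgA mulgV mul1g mulgVK.
by rewrite transvection_gen /upd (negPf ji).
Qed.

Lemma transvectionVK i u w : avoids i u -> avoids i w ->
  cancel (transvection i (rinv u) (rinv w)) (transvection i u w).
Proof.
move=> /avoids_rinv iu /avoids_rinv iw; have E : forall s : seq (letter n), rinv (rinv s) = s.
  exact: rinvK.
by have := transvectionK iu iw; rewrite !E.
Qed.

Lemma factor_image_transvection (T : Type) (f : F -> T) (Q : set T -> Prop) i u w :
  avoids i u -> avoids i w ->
  (exists2 A, proper_free_factor A & Q ((f \o transvection i u w) @` A)) ->
  exists2 A, proper_free_factor A & Q (f @` A).
Proof.
move=> iu iw; apply: (@factor_image_automorphism
  [the {multiplicative F -> F} of transvection i u w]
  [the {multiplicative F -> F} of transvection i (rinv u) (rinv w)]).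
- exact: transvectionK.
- exact: transvectionVK.
Qed.

Lemma range_transvection (T : Type) (f : F -> T) i u w : avoids i u -> avoids i w ->
  range (f \o transvection i u w) = range f.
Proof.
move=> iu iw; apply/seteqP; split=> [_ [x _ <-]|_ [x _ <-]].
  by exists (transvection i u w x).
by exists (transvection i (rinv u) (rinv w) x) => //=; rewrite transvectionVK.
Qed.

End FreeGroups.

(** * Redundancy *)

Definition proj {K : fieldType} (C : SL2 K) : PSL2 K := (\pi_(PSL2 K) C)%qT.

Section Projection.
Variable K : fieldType.

Lemma projM (B C : SL2 K) : proj (B * C)%g = (proj B * proj C)%g.
Proof. by rewrite /proj -PSL2_pi_mul. Qed.

HB.instance Definition _ := isMultiplicative.Build (SL2 K) (PSL2 K) (@proj K) projM.

Lemma proj_sign (B C : SL2 K) : proj B = proj C -> eq_upto_sign B C.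
Proof. by move/PSL2_eqP. Qed.

Lemma projX (B : SL2 K) (k : nat) : proj (B ^+ k)%g = (proj B ^+ k)%g.
Proof. by elim: k => [|k IHk]; rewrite ?expg0 ?hom1 // !expgS projM IHk. Qed.

End Projection.

Section Redundancy.
Variables (p : nat) (K : padic_field p) (n : nat).
Local Notation F := (free_group n).
Local Notation PSL := (PSL2 K).
Local Notation vge := (val_ge (@pf_val p K)).
Implicit Types (f : {multiplicative F -> PSL}) (g : 'I_n -> SL2 K) (i j : 'I_n)
  (w u : seq (letter n)) (B C : SL2 K).

(** The preimage contains both signs, so density in PSL_2 becomes approximation of every matrix of
    SL_2. *)
Definition proj_dense (D : set PSL) := forall B, approx ((@proj K) @^-1` D) B.

Definition lifts g f := forall i, proj (g i) = f (free_gen i).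

Lemma lifts_evs g f w : lifts g f -> proj (evs g w) = f (evs (@free_gen n) w).
Proof. by move=> gf; rewrite !evs_hom; congr evs; apply/funext => i; exact: gf. Qed.

Lemma lifts_word g f (x : F) : lifts g f -> f x = proj (evs g (word x)).
Proof. by move=> gf; rewrite (lifts_evs _ gf) -free_word. Qed.

Lemma range_evs g f : lifts g f -> proj_dense (range f) ->
  forall B k, exists w C, [/\ reduced w, eq_upto_sign C (evs g w) & cong k%:Z C B].
Proof.
move=> gf df B k; have [C [x _ xC] CB] := df B k.
exists (word x), C; split=> //; first exact: wordP.
by apply: proj_sign; rewrite -xC (lifts_word _ gf).
Qed.

(** A word whose image is close to [upper p] up to sign has length 0, so by freeness it would be
    empty; but modulo p^2 neither 1 nor -1 has the off-diagonal entry p. *)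
Lemma range_near_1 g f : lifts g f -> proj_dense (range f) ->
  ~ (forall w, reduced w -> w != [::] -> (0 < ell (evs g w))%N).
Proof.
move=> gf df H; have [w [C [wR Cw CB]]] := range_evs gf df (upper (p%:R : K)) 2.
have lC : ell C = 0%N.
  apply/eqP/ell_eq0P => i j; rewrite -(subrK (upper (p%:R : K) i j) (C i j)).
  apply: vgeD; first exact: vgeW (CB i j) _.
  by move: i j; apply: ord2P; apply: ord2P; rewrite /= !mk2E ?vge_0 ?vge1 ?vge_nat.
have [w0|w0] := eqVneq w [::]; last first.
  by have := H w wR w0; rewrite -(ell_sign Cw) lC.
have C01 : C 0 1 = 0.
  by move: Cw; rewrite w0 /eq_upto_sign => /orP[]/eqP->; rewrite !mxE ?oppr0.
have := CB 0 1; rewrite C01 /= mk2E sub0r vgeN vgeE ?p_neq0 // pvalp //.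
Qed.

Lemma range_unbounded g f : lifts g f -> proj_dense (range f) ->
  ~ (exists N : nat, forall w, (ell (evs g w) <= N)%N).
Proof.
move=> gf df [N H]; have P0 := expf_neq0 N.+1 (p_neq0 K).
have D : p%:R ^- N.+1 * p%:R ^+ N.+1 - 0 * 0 = 1 :> K by rewrite mulVf // mul0r subr0.
have [w [C [_ Cw CB]]] := range_evs gf df (mkSL2 D) 0.
have := H w; rewrite -(ell_sign Cw) => /ell_leP/(_ 0 0) C0.
have : vge (- N%:Z) (p%:R ^- N.+1 : K).
  rewrite -[X in vge _ X](subKr (C 0 0)); apply: vgeB => //.
  by have := CB 0 0; rewrite /= mk2E => /vgeW; apply; lia.
by rewrite vgeE ?invr_eq0 // pvalV // pvalX ?p_neq0 // pvalp; lia.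
Qed.

Lemma range_generic g f : lifts g f -> proj_dense (range f) ->
  forall x : SL2 K, exists w, forall r s : 'I_2, (evs g w ^ x)%g r s != 0.
Proof.
move=> gf df x.
(* The matrix with rows (1, 1) and (1, 2) has no entry divisible by p^2 for any prime p, so
   precision 2 keeps all entries nonzero. *)
have D : 1 * 2%:R - 1 * 1 = 1 :> K by rewrite !mul1r -[2%:R]/(1 + 1) addrK.
pose B : SL2 K := mkSL2 D; pose A := [set C | exists w, eq_upto_sign C (evs g w)].
have : approx [set (C ^ x)%g | C in A] B.
  apply: (@approx_conj _ _ _ (x^-1)%g) => k.
  have [w [C [_ Cw CB]]] := range_evs gf df (B ^ x^-1)%g k.
  by exists C => //; exists (C ^ x)%g; [exists C => //; exists w|rewrite conjgK].
move=> /(_ 2%N)[_ [C [w Cw] <-] CB]; exists w => r s.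
have nz : (C ^ x)%g r s != 0.
  apply/eqP => E; have := CB r s; rewrite E sub0r vgeN; move: r s {E}.
  by apply: ord2P; apply: ord2P; rewrite /= !mk2E ?(negPf (vge_2 K)) // vgeE ?oner_eq0 // pval1.
move: nz; rewrite !conjSL2E; case/orP: Cw => /eqP-> //.
by rewrite mulmxN mulNmx mxE oppr_eq0.
Qed.

Definition factor_dense f := exists2 A, proper_free_factor A & proj_dense (f @` A).

Lemma lifts_upd g f i u w : lifts g f ->
  lifts (upd g i (evs g u * g i * evs g w)%g) [the {multiplicative F -> PSL} of f \o transvection i u w].
Proof.
move=> gf j; rewrite /= transvection_gen /upd; case: eqP => [_|//].
by rewrite !projM !gmulfM !(lifts_evs _ gf) gf.
Qed.

Lemma factor_dense_upd (P := fun g => forall f, lifts g f -> proj_dense (range f) ->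
    torsion_free (range f) -> factor_dense f) g i u w :
  avoids i u -> avoids i w -> P (upd g i (evs g u * g i * evs g w)%g) -> P g.
Proof.
move=> iu iw Pg f gf df tf; apply: (factor_image_transvection (Q := proj_dense) iu iw).
have rE := range_transvection f iu iw.
by apply: (Pg _ (lifts_upd i u w gf)); rewrite /= rE.
Qed.

(** Erasing all letters x_i from a word does not change its image. *)
Lemma factor_dense_trivial f i : f (free_gen i) = 1%g -> proj_dense (range f) -> factor_dense f.
Proof.
move=> fi df; exists (letters_in (predC1 i)).
  by apply: (letters_in_free_factor (i := i)); rewrite inE /= eqxx.
suff -> : f @` letters_in (predC1 i) = range f by [].
apply/seteqP; split=> [_ [x _ <-]|_ [x _ <-]]; first by exists x.
exists (evs (@free_gen n) [seq a <- word x | a.1 \in (predC1 i)]).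
  by apply: letters_in_word; exact: filter_all.
rewrite [RHS]free_homE evs_hom; elim: (word x) => //= a w IHw.
case: ifP => [_ /=|/negbFE/eqP ai]; rewrite IHw //.
by rewrite /evl ai fi; case: a.2; rewrite ?invg1 mul1g.
Qed.

Hypothesis n_ge3 : (3 <= n)%N.

Section Elliptic.
Variables (i0 : 'I_n).

Lemma factor_dense_transverse g f i : lifts g f -> i != i0 -> vge 0 (\tr (g i0)) ->
  (forall k : nat, (0 < k)%N -> (g i0 ^+ k)%g != 1%g) -> transverse (g i0) (g i) ->
  factor_dense f.
Proof.
move=> gf ii0 tr0 inf0 tr_i; pose S := [pred j : 'I_n | (j == i0) || (j == i)].
have [j jS] : exists j, j \notin S.
  apply: contrapT => H; have : (#|'I_n| <= #|S|)%N.
    apply: subset_leq_card; apply/fintype.subsetP => j _; apply: contraT => jS.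
    by case: H; exists j.
  have := card2 i0 i; rewrite card_ord eq_sym ii0 /= => E; rewrite E; lia.
exists (letters_in S); first exact: letters_in_free_factor jS.
move=> B; apply: (@approx_transverse _ _ _ (g i0) (g i)) => //.
- move=> C D [x xS xC] [y yS yD]; exists (x * y)%g; first exact: letters_inM.
  by rewrite gmulfM xC yD -projM.
- move=> C [x xS xC]; exists (x^-1)%g; first exact: letters_inV.
  by rewrite homV xC -homV.
- by exists (free_gen i0); [apply: letters_in_gen; rewrite inE eqxx|rewrite gf].
- by exists (free_gen i); [apply: letters_in_gen; rewrite inE eqxx orbT|rewrite gf].
Qed.

Lemma factor_dense_hyperbolic g f j : lifts g f -> proj_dense (range f) -> j != i0 ->
  ~~ vge 0 (\tr (g j)) -> vge 0 (\tr (g i0)) ->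
  (forall k : nat, (0 < k)%N -> (g i0 ^+ k)%g != 1%g) -> factor_dense f.
Proof.
move=> gf df ji0 trj tr0 inf0.
have [i [u [w [ii0 iu iw tiu]]]] :=
  selects_hyperbolic ji0 trj (inf0 2 isT) (range_generic gf df).
apply: (factor_image_transvection (Q := proj_dense) iu iw).
apply: (factor_dense_transverse (lifts_upd i u w gf) ii0); rewrite /upd ?eqxx eq_sym (negPf ii0) //.
Qed.

Lemma factor_dense_elliptic g f : lifts g f -> proj_dense (range f) ->
  torsion_free (range f) -> vge 0 (\tr (g i0)) -> factor_dense f.
Proof.
move=> gf df tf tr0; have [f1|f1] := eqVneq (f (free_gen i0)) 1%g.
  exact: factor_dense_trivial f1 df.
have inf0 (k : nat) : (0 < k)%N -> (g i0 ^+ k)%g != 1%g.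
  move=> k0; apply: contra f1 => /eqP E; apply/eqP.
  apply: (tf _ _ k k0); first by exists (free_gen i0).
  by rewrite -gf -projX E hom1.
have [[j trj]|ell_gens] := pselect (exists j, ~~ vge 0 (\tr (g j))).
  have ji0 : j != i0 by apply: contra trj => /eqP->.
  exact: factor_dense_hyperbolic gf df ji0 trj tr0 inf0.
have {}ell_gens j : vge 0 (\tr (g j)).
  by apply: contraT => trj; case: ell_gens; exists j.
have [[i [j [ij trij]]]|ell_prods] := pselect (exists i j, i != j /\
    ~~ vge 0 (\tr (SL2_mx (g i * g j)%g))); last first.
  case: (range_unbounded gf df); apply: evs_bounded => // i j ij.
  by apply: contraT => trij; case: ell_prods; exists i, j.
(* The trace is the same for both orders of the product, so the generator replaced by the product
   can be chosen different from x_i0. *)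
wlog ji0 : i j ij trij / j != i0.
  move=> W; have [ji0|] := eqVneq j i0; last exact: W trij.
  apply: (W j i); rewrite -?ji0 // 1?eq_sym //.
  by rewrite [SL2_mx _]/(g j *m g i) mxtrace_mulC.
have ju : avoids j [:: (i, false)] by rewrite /avoids /= ij.
apply: (factor_image_transvection (Q := proj_dense) ju (isT : avoids j [::])).
have gf' := lifts_upd j [:: (i, false)] [::] gf.
apply: (factor_dense_hyperbolic gf' _ ji0).
- by rewrite /= range_transvection.
- by rewrite /upd eqxx evs1 mulg1.
- by rewrite /upd eq_sym (negPf ji0).
- by rewrite /upd eq_sym (negPf ji0).
Qed.

End Elliptic.

Theorem dense_torsion_free_factor_dense f : proj_dense (range f) ->
  torsion_free (range f) -> factor_dense f.
Proof.
(* [f] is quantified inside [P] because each Nielsen move composes it with a transvection. *)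
pose P g := forall f, lifts g f -> proj_dense (range f) ->
    torsion_free (range f) -> factor_dense f.
have PT g : P g.
  apply: nielsen_reduction g.
  - move=> g i a ai Pg; apply: (@factor_dense_upd g i [::] [:: a]) => //.
      by rewrite /avoids /= ai.
    by rewrite evs1 mul1g.
  - move=> g i a ai Pg; apply: (@factor_dense_upd g i [:: a] [::]) => //.
      by rewrite /avoids /= ai.
    by rewrite evs1 mulg1.
  - by move=> g i tri f' gf df tf; exact: factor_dense_elliptic gf df tf tri.
  - by move=> g free f' gf df; case: (range_near_1 gf df).
move=> df tf; apply: (PT (fun i => repr (f (free_gen i)))) => // i.
by rewrite /proj reprK.
Qed.

End Redundancy.

(** * From congruences to the topology of PSL_2(Q_p) *)

Section Topology.
Variables (p : nat) (p_pr : prime p).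
Local Notation Qp := (padic p_pr).
Local Notation K := (padic_field_of p_pr).
Local Notation SL := (SL2 Qp).
Local Notation PSL := (PSL2 Qp).

Lemma nbhs_padic (x : Qp) (U : set Qp) : nbhs x U <->
  exists k, [set y | padic_ideal k (x - y)] `<=` U.
Proof.
rewrite -nbhs_entourageE; split=> [[E [k _ kE] EU]|[k kU]].
  by exists k => y xy; apply: EU; apply/xsectionP; exact: kE.
exists [set xy : Qp * Qp | padic_ideal k (xy.1 - xy.2)]; first by exists k.
by move=> y /xsectionP; exact: kU.
Qed.

Lemma nbhs_SL2 (B : SL) (U : set SL) : nbhs B U <->
  exists k : nat, [set C : SL | cong (K := K) k%:Z C B] `<=` U.
Proof.
split=> [|[k kU]].
  rewrite nbhsE => -[V [[W Wo <-] WB] VU].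
  have [P PB PW] : nbhs (SL2_mx B) W by exact: open_nbhs_nbhs.
  have /choice[k kP] : forall ij : 'I_2 * 'I_2, exists k : nat,
      [set y | padic_ideal k (B ij.1 ij.2 - y)] `<=` P ij.1 ij.2.
    by move=> ij; apply/nbhs_padic; exact: PB.
  exists (\max_ij k ij)%N => C CB; apply: VU; apply: PW => i j; apply: (kP (i, j)) => /=.
  rewrite -opprB; apply: padic_idealN; apply/vge_nat_ideal; apply: (@vgeW _ K _ _ _ (CB i j)).
  by rewrite lez_nat; exact: (leq_bigmax (i, j)).
rewrite nbhsE; pose W := [set X : 'M[Qp]_2 | forall i j, padic_ideal k (X i j - B i j)].
exists (@SL2_mx Qp @^-1` W); last first.
  by move=> C CW; apply: kU => i j; apply/vge_nat_ideal; exact: CW.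
split; last by move=> i j; rewrite subrr; exact: padic_ideal0.
exists W => //; rewrite openE => X XW.
exists (fun i j => [set y | padic_ideal k (X i j - y)]) => [i j|Y XY i j].
  by apply/nbhs_padic; exists k.
rewrite -(subrKA (X i j)); apply: padic_idealD; last exact: XW.
by rewrite -opprB; apply: padic_idealN; exact: XY.
Qed.

Lemma closure_proj (D : set PSL) :
  (forall B : SL2 K, approx (K := K) (proj @^-1` D) B) -> closure D = setT.
Proof.
move=> H; apply/seteqP; split=> // z _ U; elim/quotW: z => B.
rewrite nbhsE => -[V [Vo VB] VU].
have /nbhs_SL2[k kV] : nbhs B (proj @^-1` V) by apply: open_nbhs_nbhs; split.
have [C DC CB] := H B k; exists (proj C); split; first exact: DC.
by apply: VU; exact: kV.
Qed.

Lemma dense_proj (D : set PSL) : dense D ->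
  forall B : SL2 K, approx (K := K) (proj @^-1` D) B.
Proof.
move=> dD B k; pose U := proj @` [set C : SL | cong (K := K) k%:Z C B].
have [||_ [[C CB <-] DC]] := dD U.
- exists (proj B), B => //= i j; rewrite subrr; exact: vge_0.
- suff : open (proj @^-1` U) by [].
  rewrite openE => C [C' C'B C'C].
  apply/nbhs_SL2; exists k => E EC.
  have [E' E'E E'B] := cong_sign EC (proj_sign C'C) C'B.
  by exists E' => //; apply/PSL2_eqP.
- by exists C.
Qed.

Lemma closure_dense (T : topologicalType) (D : set T) : dense D -> closure D = setT.
Proof.
move=> dD; apply/seteqP; split=> // x _ U; rewrite nbhsE => -[V [Vo Vx] VU].
have [|//|y [Vy Dy]] := dD V; first by exists x.
by exists y; split=> //; exact: VU.
Qed.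

End Topology.

Theorem theorem1p2 (n p : nat) (n_ge3 : (3 <= n)%N) (p_pr : prime p)
    (f : {multiplicative free_group n -> PSL2 (padic p_pr)}) :
  dense (range f) -> torsion_free (range f) -> redundant f.
Proof.
move=> df tf; have [A Af A_dense] := @dense_torsion_free_factor_dense p
  (padic_field_of p_pr) n n_ge3 f (dense_proj df) tf.
exists A; split=> //; last exact: closure_dense.
by rewrite (closure_dense df); exact: closure_proj.
Qed.
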